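(* Let $X$ be a compact metric space, $T:X\to X$ continuous, and $\mu$ a $T$-invariant Borel probability measure on $X$ (not necessarily ergodic). Let $Z$ be an optimal reversible coding algorithm. Then for every finite measurable partition $\alpha$ of $X$, $$h_\mu(T,\alpha)=\int_XK_Z(x,\alpha)\,d\mu=\int_X\hat H(x,\alpha)\,d\mu=\int_XK(x,\alpha)\,d\mu.$$
   Context: For $\alpha=\{A_1,\dots,A_r\}$, $\varphi_\alpha(x)=\omega\in\{1,\dots,r\}^{\mathbb{N}}$ with $T^j(x)\in A_{\omega_j}$ for all $j$; $\omega^n$ is its first $n$ symbols. $K_Z(x,\alpha)=\limsup_n|Z(\omega^n)|/n$; $K(x,\alpha)=\limsup_nAIC(\omega^n)/n$, where $AIC(s)=\min\{|P|:C(P)=s\}$ for a fixed universal computing machine $C$; $\hat H(x,\alpha)=\lim_{l\to\infty}\limsup_n\hat H_l(\omega^n)$, where for a finite string $s$ of length $n$, $P(s,w)=\frac{1}{n-l+1}\#\{0\le i\le n-l:s_{i+1}\cdots s_{i+l}=w\}$ for $|w|=l$ and $\hat H_l(s)=-\frac1l\sum_wP(s,w)\log_2P(s,w)$. A reversible coding algorithm is an injective recursive map from finite strings to binary strings; it is optimal if for each $k$ there is $f_k$ with $f_k(n)=o(n)$ and $|Z(s)|/|s|\le\hat H_k(s)+f_k(|s|)/|s|$ for all finite $s$. $h_\mu(T,\alpha)$ is the Kolmogorov–Sinai entropy of $T$ relative to $\alpha$. *)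

(* Defs.v *)
From HB Require Import structures.
From mathcomp Require Import all_boot all_order all_algebra.
From mathcomp Require Import all_classical all_reals all_analysis.
Set Implicit Arguments. Unset Strict Implicit. Unset Printing Implicit Defensive.
Import Order.TTheory GRing.Theory Num.Theory.
Import numFieldNormedType.Exports.
Local Open Scope classical_set_scope.
Local Open Scope ring_scope.

(* Bijective pairing nat * nat -> nat: <a,b> = 2^a (2b+1) - 1. *)
Definition pairn (a b : nat) : nat := (2 ^ a * (b.*2.+1)).-1.
Definition fstn (n : nat) : nat := logn 2 n.+1.
Definition sndn (n : nat) : nat := ((n.+1 %/ 2 ^ fstn n).-1)./2.

Inductive prf : Type :=
  | PZero
  | PSucc
  | PId
  | PFst
  | PSnd
  | PComp (f g : prf)
  | PPair (f g : prf)
  | PRec (f g : prf)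
  | PMu (f : prf).

Inductive eval : prf -> nat -> nat -> Prop :=
  | ev_zero x : eval PZero x 0
  | ev_succ x : eval PSucc x x.+1
  | ev_id x : eval PId x x
  | ev_fst x : eval PFst x (fstn x)
  | ev_snd x : eval PSnd x (sndn x)
  | ev_comp f g x y z : eval g x y -> eval f y z -> eval (PComp f g) x z
  | ev_pair f g x y z : eval f x y -> eval g x z -> eval (PPair f g) x (pairn y z)
  | ev_rec0 f g x y : eval f x y -> eval (PRec f g) (pairn x 0) y
  | ev_recS f g x n y z : eval (PRec f g) (pairn x n) y ->
      eval g (pairn x (pairn n y)) z -> eval (PRec f g) (pairn x n.+1) z
  | ev_mu f x n : eval f (pairn x n) 0 ->
      (forall m, (m < n)%N -> exists k, eval f (pairn x m) k.+1) ->
      eval (PMu f) x n.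

Fixpoint encs (s : seq nat) : nat :=
  if s is a :: s' then (pairn a (encs s')).+1 else 0.
Definition encb (p : seq bool) : nat := encs (map nat_of_bool p).

Definition recursive_map (Z : seq nat -> seq bool) : Prop :=
  exists c : prf, forall s, eval c (encs s) (encb (Z s)).

Definition partial_recursive (D : seq bool -> option (seq nat)) : Prop :=
  exists c : prf, forall p s, eval c (encb p) (encs s) <-> D p = Some s.

(* Universal computing machine (additively optimal, invariance theorem). *)
Definition universal_machine (C : seq bool -> option (seq nat)) : Prop :=
  partial_recursive C /\
  forall D, partial_recursive D ->
    exists c : nat, forall p s, D p = Some s ->
      exists q, C q = Some s /\ (size q <= size p + c)%N.

Definition AIC (C : seq bool -> option (seq nat)) (s : seq nat) : nat :=
  let P := fun n : nat => `[< exists p, C p = Some s /\ size p = n >] in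
  match pselect (exists n, P n) with
  | left h => ex_minn h
  | right _ => 0%N
  end.

Definition reversible_coding (Z : seq nat -> seq bool) : Prop :=
  injective Z /\ recursive_map Z.

Definition log2 {R : realType} (x : R) : R := ln x / ln 2.

Definition windows (s : seq nat) (l : nat) : seq (seq nat) :=
  if (l <= size s)%N then [seq take l (drop i s) | i <- iota 0 (size s - l).+1]
  else [::].

Definition emp_freq {R : realType} (s : seq nat) (w : seq nat) : R :=
  let ws := windows s (size w) in
  (count (pred1 w) ws)%:R / (size ws)%:R.

(* \hat H_l(s) = -(1/l) sum_{|w| = l} P(s,w) log2 P(s,w)  (terms with
   P(s,w) = 0 vanish, so the sum ranges over the occurring words) *)
Definition Hhat_l {R : realType} (l : nat) (s : seq nat) : R :=
  - (l%:R)^-1 * \sum_(w <- undup (windows s l))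
      (emp_freq s w : R) * log2 (emp_freq s w).

Definition optimal_coding {R : realType} (Z : seq nat -> seq bool) : Prop :=
  forall r k : nat, (0 < k)%N ->
    exists f : nat -> R,
      (fun n : nat => f n / n%:R) @ \oo --> (0 : R) /\
      forall s : seq nat, all (fun a => (1 <= a <= r)%N) s ->
        (size (Z s))%:R / (size s)%:R <= Hhat_l k s + f (size s) / (size s)%:R.

Definition borel (X : ptopologicalType) := g_sigma_algebraType (@open X).

Definition T_invariant {R : realType} {X : ptopologicalType} (T : X -> X)
    (mu : probability (borel X) R) : Prop :=
  forall B : set (borel X), measurable B -> mu (T @^-1` B) = mu B.

Definition measurable_partition {X : ptopologicalType} (r : nat)
    (A : 'I_r -> set X) : Prop :=
  (forall i, measurable (A i : set (borel X))) /\
  (forall i j, i != j -> A i `&` A j = set0) /\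
  (\bigcup_(i in [set: 'I_r]) A i = [set: X]).

Definition part_symbol {X : Type} (r : nat) (A : 'I_r -> set X) (y : X) : nat :=
  match pselect (exists i, A i y) with
  | left h => (val (projT1 (cid h))).+1
  | right _ => 0%N
  end.

Definition itinerary {X : Type} (T : X -> X) (r : nat) (A : 'I_r -> set X)
    (x : X) (n : nat) : seq nat :=
  [seq part_symbol A (iter j T x) | j <- iota 0 n].

Definition cylinder {X : Type} (T : X -> X) (r n : nat) (A : 'I_r -> set X)
    (w : n.-tuple 'I_r) : set X :=
  [set x | forall j : 'I_n, A (tnth w j) (iter j T x)].

Definition H_join {R : realType} {X : ptopologicalType} (mu : probability (borel X) R)
    (T : X -> X) (r : nat) (A : 'I_r -> set X) (n : nat) : R :=
  - \sum_(w : n.-tuple 'I_r)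
      fine (mu (cylinder T A w)) * log2 (fine (mu (cylinder T A w))).

Definition h_KS {R : realType} {X : ptopologicalType} (mu : probability (borel X) R)
    (T : X -> X) (r : nat) (A : 'I_r -> set X) : R :=
  limn (fun n : nat => H_join mu T A n / n%:R).

Definition K_Z {R : realType} {X : Type} (Z : seq nat -> seq bool) (T : X -> X)
    (r : nat) (A : 'I_r -> set X) (x : X) : \bar R :=
  limn_esup (fun n : nat => ((size (Z (itinerary T A x n)))%:R / n%:R : R)%:E).

Definition K_AIC {R : realType} {X : Type} (C : seq bool -> option (seq nat))
    (T : X -> X) (r : nat) (A : 'I_r -> set X) (x : X) : \bar R :=
  limn_esup (fun n : nat => ((AIC C (itinerary T A x n))%:R / n%:R : R)%:E).

Definition Hhat_x {R : realType} {X : Type} (T : X -> X) (r : nat)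
    (A : 'I_r -> set X) (x : X) : \bar R :=
  limn (fun l : nat => limn_esup (fun n : nat => (Hhat_l l (itinerary T A x n) : R)%:E)).

(* Main.v *)
Require Import Defs.
From HB Require Import structures.
From mathcomp Require Import all_boot all_order all_algebra.
From mathcomp Require Import all_classical all_reals all_analysis.
From mathcomp Require Import measurable_realfun zify ring lra.
Set Implicit Arguments.
Unset Strict Implicit.
Unset Printing Implicit Defensive.
Import Order.TTheory GRing.Theory Num.Theory.
Import numFieldNormedType.Exports.
Local Open Scope classical_set_scope.
Local Open Scope ring_scope.

(* Write [H_n] for the entropy of the law of the first [n] symbols.  Pointwise
   [K <= K_Z <= Hhat]: a program searching for the [s] with [Z s = p] gives
   [AIC s <= |Z s| + c], and optimality of [Z] gives the second inequality.
   - [int K >= limsup H_n / n].  Distinct words have distinct shortest programs,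
     so the weights [2 ^ - AIC] of the words of length [n] sum to at most [O(n)];
     Gibbs' inequality gives [H_n <= int AIC + O(log n)], and reverse Fatou
     applies because [AIC / n] is bounded through optimality of [Z].
   - [int Hhat <= (H_l + 1) / l] for every [l].  The total empirical information
     of the [l]-windows is subadditive in [l], so (Fekete) [Hhat x] is a genuine
     limit, bounded by its [l]-th term.  By Gibbs' inequality that term is at most
     the Birkhoff average of the length of a fixed code adapted to [mu], and the
     integral of the limsup of the Birkhoff averages of a bounded [g >= 0] is at
     most the integral of [g].
   The two bounds together force [H_n / n] to converge and all integrals to agree;
   neither ergodicity nor the Shannon-McMillan-Breiman theorem is involved. *)

(** * Complexity is bounded by code length *)

(* [all_analysis] also exports an [eval]. *)
Local Notation eval := Defs.eval.

Lemma pairnS (a b : nat) : (pairn a b).+1 = (2 ^ a * b.*2.+1)%N.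
Proof. by rewrite /pairn prednK// muln_gt0 expn_gt0. Qed.

Lemma fstn_pairn (a b : nat) : fstn (pairn a b) = a.
Proof.
rewrite /fstn pairnS lognM ?expn_gt0// lognX logn_prime// eqxx muln1.
by rewrite logn_coprime ?addn0// coprime2n /= odd_double.
Qed.

Lemma sndn_pairn (a b : nat) : sndn (pairn a b) = b.
Proof. by rewrite /sndn fstn_pairn pairnS mulKn ?expn_gt0//= doubleK. Qed.

Lemma pairn_fst_snd (n : nat) : pairn (fstn n) (sndn n) = n.
Proof.
apply: succn_inj; rewrite pairnS /sndn /fstn.
have [m nm1 nE] := pfactor_coprime (isT : prime 2) (ltn0Sn n).
rewrite {2}nE mulnK ?expn_gt0// [RHS]nE mulnC; congr (_ * _)%N.
have om : odd m by rewrite -coprime2n.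
by case: m om {nE nm1} => // m /= /negbTE om; rewrite even_halfK// om.
Qed.

Lemma pairn_inj (a b a' b' : nat) : pairn a b = pairn a' b' -> a = a' /\ b = b'.
Proof.
move=> e; split; first by rewrite -(fstn_pairn a b) e fstn_pairn.
by rewrite -(sndn_pairn a b) e sndn_pairn.
Qed.

Lemma encs_inj : injective encs.
Proof.
elim=> [|a s ih] [|b t] //= [] /pairn_inj [-> /ih ->] //.
Qed.

Lemma encb_inj : injective encb.
Proof.
move=> p q /encs_inj; apply: inj_map => -[] [] //.
Qed.

(** With [encs_inj] this makes [encs] a bijection, so a search over all numbers is a search over all
    words. The recursion is well founded because [sndn n <= n]. *)
Lemma encs_surj (n : nat) : exists s, encs s = n.
Proof.
elim/ltn_ind: n => -[|n] ih; first by exists [::].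
have [|s sE] := ih (sndn n).
  rewrite ltnS -{2}(pairn_fst_snd n) -ltnS pairnS.
  have : (0 < 2 ^ fstn n)%N by rewrite expn_gt0.
  by move: (2 ^ _)%N => k; nia.
by exists (fstn n :: s); rewrite /= sE pairn_fst_snd.
Qed.

(** Induction on the code. For [PMu], if two results differed, the value at the smaller one would be
    both zero and nonzero. *)
Lemma eval_inj (f : prf) (x y z : nat) : eval f x y -> eval f x z -> y = z.
Proof.
elim: f x y z => [|||||f ihf g ihg|f ihf g ihg|f ihf g ihg|f ihf] x y z.
1-5: by move=> h1 h2; inversion h1; inversion h2; subst.
- move=> h1 h2; inversion h1; inversion h2; subst.
  match goal with u : eval g x ?a, v : eval g x ?b |- _ =>
    have ? := ihg _ _ _ u v; subst b end.
  by match goal with u : eval f _ y, v : eval f _ z |- _ => exact: ihf u v end.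
- move=> h1 h2; inversion h1; inversion h2; subst.
  by congr pairn;
    [match goal with u : eval f _ ?a, v : eval f _ ?b |- ?a = ?b => exact: ihf u v end
    |match goal with u : eval g _ ?a, v : eval g _ ?b |- ?a = ?b => exact: ihg u v end].
(* Every argument is a pair, so [PRec] can be treated by induction on its second component. *)
- rewrite -{1 2}(pairn_fst_snd x); move: (fstn x) (sndn x) => a n {x}.
  elim: n y z => [|n ih] y z h1 h2; inversion h1; inversion h2; subst;
    repeat match goal with H : pairn _ _ = pairn _ _ |- _ =>
      move: H => /pairn_inj[? ?] end; try discriminate; subst;
    repeat match goal with H : S _ = S _ |- _ => case: H => ?; subst end.
    by match goal with u : eval f a y, v : eval f a z |- _ => exact: ihf u v end.
  match goal with u : eval _ (pairn a n) ?b, v : eval _ (pairn a n) ?c |- _ =>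
    have ? := ih _ _ u v; subst b end.
  by match goal with u : eval g _ y, v : eval g _ z |- _ => exact: ihg u v end.
- move=> h1 h2; inversion h1 as [| | | | | | | | |? ? ? y0 yS].
  inversion h2 as [| | | | | | | | |? ? ? z0 zS]; subst.
  case: (ltngtP y z) => // [yz|zy].
  + by have [k /(ihf _ _ _ y0)] := zS _ yz.
  + by have [k /(ihf _ _ _ z0)] := yS _ zy.
Qed.

(** * Computable arithmetic and inversion by search *)

Definition computes (f : prf) (F : nat -> nat) : Prop := forall x, eval f x (F x).

Lemma eval_rec (f g : prf) (F : nat -> nat) (G : nat -> nat -> nat -> nat) :
  computes f F -> (forall x n y, eval g (pairn x (pairn n y)) (G x n y)) ->
  forall x n, eval (PRec f g) (pairn x n)
    (nat_rect (fun=> nat) (F x) (fun n y => G x n y) n).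
Proof.
move=> hf hg x; elim=> [|n ih] /=; first exact: ev_rec0.
exact: ev_recS ih (hg _ _ _).
Qed.

Definition binary_computable (F : nat -> nat -> nat) : Prop :=
  exists c, forall a b, eval c (pairn a b) (F a b).

Lemma binary_computable_comp (F G H : nat -> nat -> nat) :
  binary_computable F -> binary_computable G -> binary_computable H ->
  binary_computable (fun a b => F (G a b) (H a b)).
Proof.
move=> [f hf] [g hg] [h hh]; exists (PComp f (PPair g h)) => a b.
exact: ev_comp (ev_pair (hg a b) (hh a b)) (hf _ _).
Qed.

Lemma eval_fst_pairn (a b : nat) : eval PFst (pairn a b) a.
Proof. by rewrite -{2}(fstn_pairn a b); exact: ev_fst. Qed.

Lemma eval_snd_pairn (a b : nat) : eval PSnd (pairn a b) b.
Proof. by rewrite -{2}(sndn_pairn a b); exact: ev_snd. Qed.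

Lemma binary_computable_fst : binary_computable (fun a _ => a).
Proof. exists PFst => a b; exact: eval_fst_pairn. Qed.

Lemma binary_computable_add : binary_computable addn.
Proof.
exists (PRec PId (PComp PSucc (PComp PSnd PSnd))) => a b.
rewrite (_ : (a + b)%N = nat_rect (fun=> nat) a (fun _ y => y.+1) b); last first.
  by elim: b => [|b ih] /=; rewrite ?addn0// addnS ih.
apply: (@eval_rec _ _ (fun a => a) (fun _ _ y => y.+1)) => [|x n y]; first exact: ev_id.
apply: ev_comp (ev_succ _); apply: ev_comp (eval_snd_pairn n y).
exact: eval_snd_pairn.
Qed.

(** Primitive recursion whose step returns the counter and discards the previous value. *)
Lemma computes_pred : exists c, computes c predn.
Proof.
exists (PComp (PRec PZero (PComp PFst PSnd)) (PPair PZero PId)) => n.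
apply: (ev_comp (ev_pair (ev_zero _) (ev_id n))).
rewrite (_ : n.-1 = nat_rect (fun=> nat) 0%N (fun n _ => n) n); last by case: n.
apply: (@eval_rec _ _ (fun=> 0%N) (fun _ n _ => n)) => [|x m y]; first exact: ev_zero.
exact: ev_comp (eval_snd_pairn _ _) (eval_fst_pairn _ _).
Qed.

Lemma binary_computable_sub : binary_computable subn.
Proof.
have [p hp] := computes_pred.
exists (PRec PId (PComp p (PComp PSnd PSnd))) => a b.
rewrite (_ : (a - b)%N = nat_rect (fun=> nat) a (fun _ y => y.-1) b); last first.
  by elim: b => [|b ih] /=; rewrite ?subn0// subnS ih.
apply: (@eval_rec _ _ (fun a => a) (fun _ _ y => y.-1)) => [|x n y]; first exact: ev_id.
apply: ev_comp (hp _).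
exact: ev_comp (eval_snd_pairn _ _) (eval_snd_pairn _ _).
Qed.

(* The code searches for the [n] with [|f n - x| = 0]. *)
Lemma computes_inverse (f : prf) (F : nat -> nat) :
  computes f F -> injective F ->
  exists c, forall x n, eval c x n <-> F n = x.
Proof.
move=> hf Finj.
have bF : binary_computable (fun _ b => F b).
  by exists (PComp f PSnd) => a b; exact: ev_comp (eval_snd_pairn _ _) (hf _).
(* Both differences are truncated, so their sum is the distance between [x] and [F n]. *)
have [d hd] : binary_computable (fun x n => (x - F n) + (F n - x))%N.
  have b1 := binary_computable_comp binary_computable_sub
    binary_computable_fst bF.
  have b2 := binary_computable_comp binary_computable_sub bF
    binary_computable_fst.
  exact: binary_computable_comp binary_computable_add b1 b2.
exists (PMu d) => x n; split=> [h|<-].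
  inversion h as [| | | | | | | | |? ? ? h0 hS]; subst.
  by have := eval_inj h0 (hd x n); lia.
apply: ev_mu => [|m mn].
  by have := hd (F n) n; rewrite subnn.
(* Injectivity of [F] makes every earlier distance positive, so the search does not stop before
   [n]. *)
exists ((F n - F m) + (F m - F n)).-1.
rewrite prednK//; have : F n <> F m by move=> /Finj nm; rewrite nm ltnn in mn.
lia.
Qed.

(** Read through the bijection [encs], [Z] is a total injective computable function on numbers, and
    [computes_inverse] applies. The decoder is undefined exactly outside the range of [Z]. *)
Lemma partial_recursive_inverse (Z : seq nat -> seq bool) : reversible_coding Z ->
  exists2 D, partial_recursive D & forall s, D (Z s) = Some s.
Proof.
move=> [Zinj [c hc]].
pose dec n : seq nat := projT1 (cid (encs_surj n)).
have decK n : encs (dec n) = n by rewrite /dec; case: cid.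
have decE s : dec (encs s) = s by apply: encs_inj; rewrite decK.
have [d hd] : exists d, forall x n, eval d x n <-> encb (Z (dec n)) = x.
  apply: (@computes_inverse c) => [n|m n /encb_inj/Zinj e].
    by rewrite -{1}(decK n); exact: hc.
  by rewrite -(decK m) e decK.
pose D p := if pselect (exists s, Z s = p) is left h
            then Some (projT1 (cid h)) else None.
have DP p s : D p = Some s <-> Z s = p.
  rewrite /D; case: pselect => [h|nh].
    case: cid => t /= tp; split => [[<-]//|sp]; congr Some.
    by apply: Zinj; rewrite sp.
  by split => // sp; exfalso; apply: nh; exists s.
exists D => [|s]; last exact/DP.
exists d => p s; rewrite DP hd decE; split=> [/encb_inj //|-> //].
Qed.

Lemma AIC_le_size (C : seq bool -> option (seq nat)) (q : seq bool) (s : seq nat) :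
  C q = Some s -> (AIC C s <= size q)%N.
Proof.
move=> Cq; rewrite /AIC; case: pselect => // h.
by case: ex_minnP => m _; apply; apply/asboolP; exists q.
Qed.

(** Once some program produces [s], [AIC C s] is an attained minimum and not the default [0] of its
    definition. *)
Lemma AIC_program (C : seq bool -> option (seq nat)) (q : seq bool) (s : seq nat) :
  C q = Some s -> exists2 p, C p = Some s & size p = AIC C s.
Proof.
move=> Cq; rewrite /AIC; case: pselect => [h|[]].
  by case: ex_minnP => m /asboolP[p [Cp pm]] _; exists p.
by exists (size q); apply/asboolP; exists q.
Qed.

(** For the decoder of [Z], the string [Z s] is a program for [s]; universality of [C] costs a
    constant. It also gives every word a program, so all values of [AIC] are attained. *)
Lemma AIC_le_coding (C : seq bool -> option (seq nat)) (Z : seq nat -> seq bool) :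
  universal_machine C -> reversible_coding Z ->
  exists c, forall s, (AIC C s <= size (Z s) + c)%N /\
    exists2 p, C p = Some s & size p = AIC C s.
Proof.
move=> [_ univ] /partial_recursive_inverse[D /univ[c hc] DZ].
exists c => s; have [q [Cq qs]] := hc _ _ (DZ s).
split; first exact: leq_trans (AIC_le_size Cq) qs.
exact: AIC_program Cq.
Qed.

(** * Empirical information *)

Lemma ln2_gt0 (R : realType) : 0 < ln 2 :> R.
Proof. by rewrite ln_gt0// ltr1n. Qed.

Lemma ln2_ge0 (R : realType) : 0 <= ln 2 :> R.
Proof. exact/ltW/ln2_gt0. Qed.

Lemma log2M (R : realType) (x y : R) : 0 < x -> 0 < y -> log2 (x * y) = log2 x + log2 y.
Proof. by move=> x0 y0; rewrite /log2 lnM ?posrE// mulrDl. Qed.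

Lemma log2V (R : realType) (x : R) : 0 < x -> log2 x^-1 = - log2 x.
Proof. by move=> x0; rewrite /log2 lnV ?posrE//; rewrite mulNr. Qed.

Lemma log2_2 (R : realType) : log2 2 = 1 :> R.
Proof. by rewrite /log2 divff// gt_eqF// ln2_gt0. Qed.

Lemma log2Xn (R : realType) (x : R) (n : nat) : 0 < x -> log2 (x ^+ n) = n%:R * log2 x.
Proof. by move=> x0; rewrite /log2 lnXn// -[ln x *+ n]mulr_natl mulrA. Qed.

Lemma ler_log2 (R : realType) (x y : R) : 0 < x -> x <= y -> log2 x <= log2 y.
Proof.
move=> x0 xy; rewrite /log2 ler_pM2r ?invr_gt0 ?ln2_gt0//.
by rewrite ler_ln ?posrE// (lt_le_trans x0).
Qed.

Lemma log2_le0 (R : realType) (x : R) : x <= 1 -> log2 x <= 0.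
Proof. by move=> x1; rewrite /log2 mulr_le0_ge0 ?ln_le0// invr_ge0 ln2_ge0. Qed.

Lemma log2_ge0 (R : realType) (x : R) : 1 <= x -> 0 <= log2 x.
Proof. by move=> x1; rewrite /log2 divr_ge0 ?ln_ge0// ler1n. Qed.

Lemma log2_le_subr1 (R : realType) (x : R) : 0 < x -> log2 x <= (x - 1) / ln 2.
Proof.
move=> x0; rewrite /log2 ler_pM2r ?invr_gt0 ?ln2_gt0//.
by rewrite -{1}(subrKC 1 x) le_ln1Dx// ltrBrDl subrr.
Qed.

(** Apply [log2 x <= (x - 1) / ln 2] to [x = q i / (S * p i)] and average with weights [p i];
    indices with [p i = 0] are harmless. The weights [q] need not be normalised: a total mass of at
    most [S] costs [log2 S]. *)
Lemma gibbs (R : realType) (I : Type) (s : seq I) (p q : I -> R) (S : R) :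
  (forall i, 0 <= p i) -> (forall i, 0 < q i) -> \sum_(i <- s) p i = 1 ->
  0 < S -> \sum_(i <- s) q i <= S ->
  - (\sum_(i <- s) p i * log2 (p i)) <= \sum_(i <- s) p i * - log2 (q i) + log2 S.
Proof.
move=> p0 q0 p1 S0 qS; rewrite -subr_le0 opprD addrA.
have -> : log2 S = \sum_(i <- s) p i * log2 S by rewrite -mulr_suml p1 mul1r.
rewrite -!sumrN -!big_split/=.
apply: (@le_trans _ _ (\sum_(i <- s) (q i / S - p i) / ln 2)).
  apply: ler_sum => i _; have [pi0|pi0] := eqVneq (p i) 0.
    rewrite pi0 !mul0r !(oppr0, addr0).
    by rewrite !divr_ge0 ?ln2_ge0// ltW.
  have pip : 0 < p i by rewrite lt_neqAle eq_sym pi0 p0.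
  have := @log2_le_subr1 R (q i / S / p i).
  rewrite !divr_gt0// => /(_ isT); rewrite !log2M ?log2V ?invr_gt0 ?divr_gt0//.
  move=> /(ler_wpM2l (p0 i)).
  have -> : p i * ((q i / S / p i - 1) / ln 2) = (q i / S - p i) / ln 2.
    by field; rewrite pi0 !gt_eqF// ln2_gt0.
  by apply: le_trans; rewrite !mulrDr !mulrN opprK; lra.
rewrite -mulr_suml big_split/= sumrN p1 -mulr_suml.
rewrite mulr_le0_ge0 ?invr_ge0 ?ln2_ge0//.
by rewrite subr_le0 ler_pdivrMr// mul1r.
Qed.

Lemma sum_undup_count (R : realType) (I : eqType) (s : seq I) (F : I -> R) :
  \sum_(i <- s) F i = \sum_(i <- undup s) (count_mem i s)%:R * F i.
Proof.
rewrite -big_undup_iterop_count; apply: eq_bigr => i _.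
by rewrite mulr_natl /Algebra.natmul.
Qed.

(** [gibbs] for the empirical law of [s], multiplied by [size s] so that both sides become sums over
    positions. *)
Lemma gibbs_seq (R : realType) (I : eqType) (s : seq I) (q : I -> R) :
  (forall i, 0 < q i) -> \sum_(i <- undup s) q i <= 1 ->
  \sum_(i <- s) - log2 ((count_mem i s)%:R / (size s)%:R : R) <= \sum_(i <- s) - log2 (q i).
Proof.
move=> q0 q1; have [s0|s0] := posnP (size s).
  by rewrite (size0nil s0) !big_nil.
pose p i : R := (count_mem i s)%:R / (size s)%:R.
have p1 : \sum_(i <- undup s) p i = 1.
  have := @sum_undup_count R I s (fun=> (size s)%:R^-1); rewrite /p => <-.
  by rewrite big_const_seq count_predT iter_addr_0 -[LHS]mulr_natl divff// pnatr_eq0 -lt0n.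
have := @gibbs R I (undup s) p q 1 (fun i => divr_ge0 (ler0n _ _) (ler0n _ _)) q0 p1 ltr01 q1.
rewrite /log2 ln1 mul0r addr0 -sumrN => h.
rewrite [leLHS]sum_undup_count [leRHS]sum_undup_count.
have sE i : (count_mem i s)%:R = (size s)%:R * p i.
  by rewrite /p mulrC divfK// pnatr_eq0 -lt0n.
under eq_bigr do rewrite [X in X * _]sE -mulrA mulrN.
under [leRHS]eq_bigr do rewrite [X in X * _]sE -mulrA.
by rewrite -!mulr_sumr ler_wpM2l.
Qed.

(** The entropy of the empirical law of the [l]-windows times their number, hence [Hhat_l l s]
    without its two normalisations. In this form it is subadditive in [l] with no error term. *)
Definition information (R : realType) (l : nat) (s : seq nat) : R :=
  \sum_(w <- windows s l) - log2 (emp_freq s w).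

Lemma size_windows (s : seq nat) (l : nat) : (l <= size s)%N ->
  size (windows s l) = (size s - l).+1.
Proof. by move=> ls; rewrite /windows ls size_map size_iota. Qed.

Lemma size_mem_windows (s : seq nat) (l : nat) (w : seq nat) :
  w \in windows s l -> size w = l.
Proof.
rewrite /windows; case: ifP => // ls /mapP[i]; rewrite mem_iota/= => il ->.
by rewrite size_takel// size_drop; lia.
Qed.

Lemma emp_freqE (R : realType) (s : seq nat) (l : nat) (w : seq nat) : w \in windows s l ->
  emp_freq s w = (count_mem w (windows s l))%:R / (size (windows s l))%:R :> R.
Proof. by move=> /size_mem_windows; rewrite /emp_freq => ->. Qed.

Lemma emp_freq_le1 (R : realType) (s w : seq nat) : emp_freq s w <= 1 :> R.
Proof.
rewrite /emp_freq; have [->|n0] := posnP (size (windows s (size w))).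
  by rewrite invr0 mulr0.
by rewrite ler_pdivrMr ?ltr0n// mul1r ler_nat count_size.
Qed.

Lemma emp_freq_gt0 (R : realType) (s w : seq nat) : w \in windows s (size w) ->
  0 < emp_freq s w :> R.
Proof.
move=> ws; rewrite /emp_freq divr_gt0// ltr0n.
  by rewrite -has_count; apply/hasP; exists w => /=.
by case: (windows _ _) ws.
Qed.

Lemma information_ge0 (R : realType) (l : nat) (s : seq nat) : 0 <= information R l s.
Proof. by apply: sumr_ge0 => w _; rewrite oppr_ge0 log2_le0// emp_freq_le1. Qed.

Lemma information_le (R : realType) (l : nat) (s : seq nat) (q : seq nat -> R) :
  (forall w, 0 < q w) -> \sum_(w <- undup (windows s l)) q w <= 1 ->
  information R l s <= \sum_(w <- windows s l) - log2 (q w).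
Proof.
move=> q0 q1; apply: le_trans (gibbs_seq q0 q1).
rewrite /information !big_seq le_eqVlt; apply/orP; left; apply/eqP.
by apply: eq_bigr => w /(emp_freqE R) ->.
Qed.

Lemma Hhat_lE (R : realType) (l : nat) (s : seq nat) :
  Hhat_l l s = information R l s / (l%:R * (size (windows s l))%:R).
Proof.
rewrite /Hhat_l mulNr -mulrN -sumrN.
have -> : \sum_(w <- undup (windows s l)) - ((emp_freq s w : R) * log2 (emp_freq s w)) =
    information R l s / (size (windows s l))%:R.
  rewrite /information [in RHS]sum_undup_count mulr_suml !big_seq.
  apply: eq_bigr => w; rewrite mem_undup => ws.
  by rewrite [in RHS]mulrN mulNr {1}(emp_freqE R ws) mulrAC.
by rewrite invfM mulrCA.
Qed.

Lemma sum_emp_freq (R : realType) (l : nat) (s : seq nat) : (l <= size s)%N ->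
  \sum_(w <- undup (windows s l)) emp_freq s w = 1 :> R.
Proof.
move=> ls; pose ws := windows s l.
transitivity (\sum_(w <- undup ws) (count_mem w ws)%:R * (size ws)%:R^-1 : R).
  rewrite !big_seq; apply: eq_bigr => w; rewrite mem_undup => /(emp_freqE R) ->.
  by [].
rewrite -(@sum_undup_count R _ ws (fun=> (size ws)%:R^-1)).
rewrite big_const_seq count_predT iter_addr_0 -[LHS]mulr_natl divff//.
by rewrite pnatr_eq0 size_windows.
Qed.

Lemma sum_windows (R : realType) (l : nat) (s : seq nat) (F : seq nat -> R) :
  (l <= size s)%N -> \sum_(w <- windows s l) F w =
  \sum_(0 <= i < (size s - l).+1) F (take l (drop i s)).
Proof. by move=> ls; rewrite /windows ls big_map /index_iota subn0. Qed.

Lemma mem_windows (s : seq nat) (l i : nat) : (i + l <= size s)%N ->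
  take l (drop i s) \in windows s l.
Proof.
move=> ils; rewrite /windows ifT; last by lia.
by apply/mapP; exists i => //; rewrite mem_iota/=; lia.
Qed.

Lemma ler_sum_sub_uniq (R : realType) (I : eqType) (s t : seq I) (F : I -> R) :
  (forall i, 0 <= F i) -> uniq s -> {subset s <= t} ->
  \sum_(i <- s) F i <= \sum_(i <- t) F i.
Proof.
move=> F0; elim: s t => [|x s ih] t; first by rewrite big_nil sumr_ge0.
move=> /andP[xs us] st; have xt : x \in t by rewrite st// mem_head.
rewrite big_cons [leRHS](big_rem x)//= lerD2l ih// => y ys.
have : y \in t by rewrite st// inE ys orbT.
rewrite (perm_mem (perm_to_rem xt)) inE => /predU1P[yx|//].
by rewrite -yx ys in xs.
Qed.

(* Comparing the empirical law of words of length [l + m] with the product of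
   the empirical laws of its two blocks. *)
Lemma information_subadditive (R : realType) (l m : nat) (s : seq nat) :
  (l + m <= size s)%N ->
  information R (l + m) s <= information R l s + information R m s.
Proof.
move=> lms.
have blocks w : w \in windows s (l + m) ->
    (take l w \in windows s l) && (drop l w \in windows s m).
  rewrite /windows lms => /mapP[i]; rewrite mem_iota/= => il ->.
  rewrite take_takel ?leq_addr// (addnC l m) -take_drop drop_drop.
  by rewrite !mem_windows//; lia.
(* The value [1] on absent words only keeps [q] positive everywhere; those words do not enter the
   sum of weights. *)
pose q w : R := if w \in windows s (l + m)
                then emp_freq s (take l w) * emp_freq s (drop l w) else 1.
have q0 w : 0 < q w.
  rewrite /q; case: ifPn => // /blocks /andP[wl wm].
  by rewrite mulr_gt0 ?emp_freq_gt0//; rewrite (size_mem_windows wl, size_mem_windows wm).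
have q1 : \sum_(w <- undup (windows s (l + m))) q w <= 1.
  (* Splitting a word is injective, so the weights are some of the terms of a product of two sums,
     each equal to [1]. *)
  pose split (w : seq nat) := (take l w, drop l w).
  rewrite [leLHS](_ : _ = \sum_(x <- [seq split w | w <- undup (windows s (l + m))])
      emp_freq s x.1 * emp_freq s x.2); last first.
    rewrite big_map !big_seq; apply: eq_bigr => w; rewrite mem_undup => ws.
    by rewrite /q ws.
  apply: (@le_trans _ _ (\sum_(x <- [seq (u, v) | u <- undup (windows s l),
      v <- undup (windows s m)]) emp_freq s x.1 * emp_freq s x.2)).
    apply: ler_sum_sub_uniq => [x||x].
    - by rewrite mulr_ge0// divr_ge0.
    - rewrite map_inj_uniq ?undup_uniq// => u v [uv1 uv2].
      by rewrite -(cat_take_drop l u) uv1 uv2 cat_take_drop.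
    - move=> /mapP[w]; rewrite mem_undup => /blocks /andP[wl wm] ->.
      by apply: allpairs_f; rewrite mem_undup.
  rewrite big_allpairs/=; under eq_bigr do rewrite -mulr_sumr.
  by rewrite -mulr_suml !sum_emp_freq ?mul1r//; lia.
apply: le_trans (information_le q0 q1) _.
have -> : \sum_(w <- windows s (l + m)) - log2 (q w) =
    \sum_(w <- windows s (l + m)) - log2 (emp_freq s (take l w) : R) +
    \sum_(w <- windows s (l + m)) - log2 (emp_freq s (drop l w) : R).
  rewrite -big_split/= !big_seq; apply: eq_bigr => w ws.
  have /andP[wl wm] := blocks _ ws.
  rewrite /q ws log2M ?opprD// emp_freq_gt0//.
    by rewrite (size_mem_windows wl).
  by rewrite (size_mem_windows wm).
have nonneg w : 0 <= - log2 (emp_freq s w : R).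
  by rewrite oppr_ge0 log2_le0// emp_freq_le1.
rewrite /information !sum_windows//; [|lia..].
apply: lerD.
  (* The first blocks are the [l]-windows at the initial positions; the remaining [l]-windows
     contribute nonnegative terms. *)
  rewrite [leRHS](@big_cat_nat _ _ _ (size s - (l + m)).+1)//=; last by lia.
  rewrite ler_wpDr ?sumr_ge0// le_eqVlt; apply/orP; left; apply/eqP.
  by apply: eq_bigr => i _; rewrite take_takel// leq_addr.
(* The second blocks are the [m]-windows that start at position [l] or later. *)
rewrite [leRHS](@big_cat_nat _ _ _ l)//=; last by lia.
rewrite ler_wpDl ?sumr_ge0//.
have := @big_addn R 0 +%R 0%N (size s - m).+1 l xpredT
  (fun i => - log2 (emp_freq s (take m (drop i s)))).
rewrite add0n => ->.
rewrite (_ : ((size s - m).+1 - l)%N = (size s - (l + m)).+1); last by lia.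
rewrite le_eqVlt; apply/orP; left; apply/eqP.
by apply: eq_bigr => i _; rewrite (addnC l m) -take_drop drop_drop addnC.
Qed.

(** Comparison of the empirical law of the letters with the uniform law on [r] symbols. *)
Lemma information1_le (R : realType) (r : nat) (s : seq nat) :
  all (fun a => (1 <= a <= r)%N) s ->
  information R 1 s <= (size s)%:R * log2 r%:R.
Proof.
case: s => [|a s] hs; first by rewrite /information big_nil mul0r.
have r0 : (0 < r)%N by move: hs => /=; lia.
have r0R : (0 : R) < r%:R by rewrite ltr0n.
apply: (le_trans (@information_le R 1 (a :: s) (fun=> r%:R^-1) _ _)).
- by move=> _; rewrite invr_gt0.
- rewrite big_const_seq count_predT iter_addr_0 -[leLHS]mulr_natl ler_pdivrMr// mul1r ler_nat.
  suff : (size (undup (windows (a :: s) 1)) <= size [seq [:: b] | b <- iota 1 r])%N.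
    by rewrite size_map size_iota.
  apply: uniq_leq_size; first exact: undup_uniq.
  move=> w; rewrite mem_undup => /mapP[i]; rewrite mem_iota/= => ia ->.
  have i_s : (i < size (a :: s))%N by move: ia => /=; lia.
  rewrite (drop_nth 0%N i_s) /= take0; apply: map_f; rewrite mem_iota add1n ltnS.
  exact: (allP hs _ (mem_nth 0%N i_s)).
rewrite big_const_seq count_predT iter_addr_0 -[leLHS]mulr_natl log2V// opprK.
rewrite ler_wpM2r ?log2_ge0 ?ler1n// ler_nat size_windows//=; lia.
Qed.

(** Subadditivity reduces this to single letters. A word shorter than [l] has no windows and no
    information. *)
Lemma information_le_size (R : realType) (r l : nat) (s : seq nat) :
  all (fun a => (1 <= a <= r)%N) s -> (0 < l)%N ->
  information R l s <= l%:R * ((size s)%:R * log2 r%:R).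
Proof.
move=> hs l0; have [sl|] := ltnP (size s) l.
  rewrite /information /windows leqNgt sl big_nil.
  case: s hs {sl} => [|a s] hs; first by rewrite mul0r mulr0.
  apply: mulr_ge0 => //; apply: mulr_ge0 => //; apply: log2_ge0.
  by rewrite ler1n; move: hs => /=; lia.
elim: l l0 => // -[_ _ _|l ih _ ls]; first by rewrite mul1r information1_le.
rewrite -addn1; apply: le_trans (information_subadditive _ _) _; first by lia.
by rewrite natrD mulrDl mul1r lerD// ?information1_le// ih//; lia.
Qed.

(** * Information rate of a sequence of words *)

Local Open Scope ereal_scope.

Lemma le_limn_esup (R : realType) (u v : nat -> \bar R) :
  (\forall n \near \oo, u n <= v n) -> limn_esup u <= limn_esup v.
Proof.
move=> uv; rewrite /limn_esup !limf_esupE; apply: le_ereal_inf_tmp => _ [V oV <-].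
apply: (@le_trans _ _ (ereal_sup (u @` (V `&` [set n | u n <= v n])))).
  by apply: ereal_inf_lbound; exists (V `&` [set n | u n <= v n]) => //; exact: filterI.
apply: ge_ereal_sup => _ [n [Vn uvn] <-]; apply: le_trans uvn _.
by apply: ereal_sup_ubound; exists n.
Qed.

(** With [limn_esup_near_le], the epsilon form of an upper bound on a limsup, which moves estimates
    between [\bar R] and [R]. *)
Lemma limn_esup_le (R : realType) (u : nat -> R) (c : R) :
  (forall e : R, (0 < e)%R -> \forall n \near \oo, (u n <= c + e)%R) ->
  limn_esup (fun n => (u n)%:E) <= c%:E.
Proof.
move=> uc; apply/lee_addgt0Pr => e e0; rewrite /limn_esup limf_esupE.
apply: (@le_trans _ _ (ereal_sup ((EFin \o u) @` [set n | (u n <= c + e)%R]))).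
  by apply: ereal_inf_lbound; exists [set n | (u n <= c + e)%R] => //; exact: uc.
by apply: ge_ereal_sup => _ [n /= un <-]; rewrite -EFinD lee_fin.
Qed.

Lemma limn_esup_near_le (R : realType) (u : nat -> R) (c e : R) :
  limn_esup (fun n => (u n)%:E) <= c%:E -> (0 < e)%R ->
  \forall n \near \oo, (u n <= c + e)%R.
Proof.
move=> uc e0; have : limn_esup (fun n => (u n)%:E) < (c + e)%:E.
  by apply: le_lt_trans uc _; rewrite lte_fin ltrDl.
rewrite /limn_esup limf_esupE => /ereal_inf_lt[_ [V oV <-]] Ve.
apply: filterS oV => n Vn; rewrite -lee_fin; apply: le_trans (ltW Ve).
by apply: ereal_sup_ubound; exists n.
Qed.

Lemma limn_esup_ge0 (R : realType) (u : nat -> \bar R) :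
  (forall n, 0 <= u n) -> 0 <= limn_esup u.
Proof. exact: limf_esup_ge0. Qed.

Lemma limn_esup_EFin (R : realType) (u : nat -> R) (K : R) :
  (forall n, (0 <= u n)%R) -> (\forall n \near \oo, (u n <= K)%R) ->
  (fine (limn_esup (fun n => (u n)%:E)))%:E = limn_esup (fun n => (u n)%:E).
Proof.
move=> u0 uK; rewrite fineK// ge0_fin_numE; last first.
  by apply: limn_esup_ge0 => n; rewrite lee_fin.
apply: le_lt_trans (ltry K); apply: limn_esup_le => e e0.
by apply: filterS uK => n /le_trans; apply; rewrite lerDl ltW.
Qed.

Local Close Scope ereal_scope.

Lemma near_ge1 : \forall n \near \oo, (0 < n)%N.
Proof. by exists 1%N. Qed.

Lemma near_ler_inv (R : realType) (K e : R) : 0 < e -> \forall n \near \oo, K / n%:R <= e.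
Proof.
move=> e0; near=> n; have n0 : (0 < n)%N by near: n; exact: near_ge1.
rewrite ler_pdivrMr ?ltr0n// -ler_pdivrMl//.
by near: n; exact: nbhs_infty_ger.
Unshelve. all: by end_near. Qed.

(** A bounded error in the unnormalised quantities disappears after division by [n]: this absorbs
    the constant of universality and the boundary terms of Birkhoff sums. *)
Lemma le_limn_esup_error (R : realType) (u v : nat -> R) (K : R) :
  (forall n, 0 <= v n) -> (forall n, u n <= v n + K / n%:R) ->
  (limn_esup (fun n => (u n)%:E) <= limn_esup (fun n => (v n)%:E))%E.
Proof.
move=> v0 uv; case cE: (limn_esup (fun n => (v n)%:E)) => [c| |].
- apply: limn_esup_le => e e0; have e20 : 0 < e / 2 by rewrite divr_gt0.
  near=> n; have h1 : v n <= c + e / 2.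
    by near: n; apply: limn_esup_near_le => //; rewrite cE.
  have h2 : K / n%:R <= e / 2 by near: n; exact: near_ler_inv.
  by have := uv n; lra.
- by rewrite leey.
- suff : (0 <= limn_esup (fun n => (v n)%:E))%E by rewrite cE.
  by apply: limn_esup_ge0 => n; rewrite lee_fin.
Unshelve. all: by end_near. Qed.

(** The limit is the infimum of the quotients [a l / l], which exists in [R] because they are
    nonnegative. *)
Lemma fekete (R : realType) (a : nat -> R) : (forall n, 0 <= a n) ->
  (forall l m, a (l + m)%N <= a l + a m) ->
  exists2 L : R, (fun n => a n / n%:R) @ \oo --> L & forall l, (0 < l)%N -> L <= a l / l%:R.
Proof.
move=> a0 aD; pose E := [set a l / l%:R | l in [set l | (0 < l)%N]].
have Elb : has_lbound E by exists 0 => _ [l _ <-]; rewrite divr_ge0.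
have Einf : has_inf E by split => //; exists (a 1%N / 1%:R); exists 1%N.
have Lle l : (0 < l)%N -> inf E <= a l / l%:R.
  by move=> l0; apply: ge_inf => //; exists l.
exists (inf E) => //; apply/cvgrPdist_le => e e0.
have e20 : 0 < e / 2 by rewrite divr_gt0.
have [_ [l l0 <-] le2] := inf_adherent e20 Einf.
pose M := \sum_(i < l.+1) a i.
(* Division of [n] by [l] as a strong induction: each block of length [l] costs [a l], and [M]
   bounds the value at any remainder. *)
have aM n : a n <= n%:R * (a l / l%:R) + M.
  elim/ltn_ind: n => n ih; have [nl|ln] := leqP n l.
    have nl1 : (n < l.+1)%N by [].
    rewrite ler_wpDl ?mulr_ge0 ?divr_ge0//.
    by rewrite /M (bigD1 (Ordinal nl1))//= lerDl sumr_ge0.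
  rewrite -(subnKC (ltnW ln)); apply: le_trans (aD _ _) _.
  rewrite natrD mulrDl mulrCA divff ?mulr1 ?pnatr_eq0 -?lt0n// -addrA lerD2l.
  by apply: ih; move: l0 => /=; lia.
near=> n; have n0 : (0 < n)%N by near: n; exact: near_ge1.
rewrite distrC ger0_norm ?subr_ge0 ?Lle//.
have Mn : M / n%:R <= e / 2 by near: n; exact: near_ler_inv.
have : a n / n%:R <= a l / l%:R + M / n%:R.
  by rewrite ler_pdivrMr ?ltr0n// mulrDl divfK ?pnatr_eq0 -?lt0n// mulrC.
lra.
Unshelve. all: by end_near. Qed.

(** Writing [log2 y] as twice the logarithm of the square root of [y], the linear bound
    [log2_le_subr1] gives growth of order at most the square root of [n]. *)
Lemma near_log2_ler (R : realType) (B : nat) (e : R) : 0 < e ->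
  \forall n \near \oo, log2 (B * n).+1%:R / n%:R <= e.
Proof.
(* Chosen so that [2 * (c * n) / ln 2 = e * n]; the square root of [y] is at most [c * n] once
   [B.+1 / n <= c ^+ 2]. *)
move=> e0; pose c : R := e * ln 2 / 2.
have c0 : 0 < c by rewrite !divr_gt0// mulr_gt0// ln2_gt0.
have h := @near_ler_inv R B.+1%:R (c ^+ 2) (exprn_gt0 _ c0).
near=> n; have n0 : (0 < n)%N by near: n; exact: near_ge1.
have nR : (0 : R) < n%:R by rewrite ltr0n.
have hn : B.+1%:R / n%:R <= c ^+ 2 by near: n; exact: h.
set y : R := (B * n).+1%:R; have y0 : 0 < y by rewrite ltr0n.
have sy : Num.sqrt y <= c * n%:R.
  have cn0 : 0 <= c * n%:R by rewrite mulr_ge0// ltW.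
  rewrite -[leRHS]ger0_norm// -sqrtr_sqr ler_sqrt ?exprn_ge0// exprMn.
  apply: (@le_trans _ _ (B.+1%:R * n%:R)).
    by rewrite /y -natrM ler_nat; nia.
  by move: hn; rewrite ler_pdivrMr// => hn; rewrite expr2 mulrA ler_wpM2r// ltW.
rewrite ler_pdivrMr// -(sqr_sqrtr (ltW y0)) log2Xn ?sqrtr_gt0//.
have s0 : 0 < Num.sqrt y by rewrite sqrtr_gt0.
have -> : e * n%:R = 2 * (c * n%:R / ln 2) by rewrite /c; field; rewrite gt_eqF ?ln2_gt0.
rewrite ler_pM2l//; apply: le_trans (log2_le_subr1 s0) _.
by rewrite ler_pM2r ?invr_gt0 ?ln2_gt0//; lra.
Unshelve. all: by end_near. Qed.

(** Division by [n], neither by the number of windows nor by [l], keeps the rate subadditive in [l].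
    For [words] the limsup is finite, so [fine] loses nothing. *)
Definition information_rate (R : realType) (w : nat -> seq nat) (l : nat) : R :=
  fine (limn_esup (fun n => (information R l (w n) / n%:R)%:E)).

Definition words (r : nat) (w : nat -> seq nat) : Prop :=
  forall n, size (w n) = n /\ all (fun a => (1 <= a <= r)%N) (w n).

Lemma information_div_le (R : realType) (r : nat) (w : nat -> seq nat) (l n : nat) :
  words r w -> (0 < l)%N -> information R l (w n) / n%:R <= l%:R * log2 r%:R.
Proof.
move=> hw l0; have [wn hr] := hw n; have [->|n0] := posnP n.
  rewrite invr0 mulr0; apply: mulr_ge0 => //; have [->|r0] := posnP r.
    by rewrite /log2 ln0// mul0r.
  by apply: log2_ge0; rewrite ler1n.
rewrite ler_pdivrMr ?ltr0n//; apply: le_trans (information_le_size R hr l0) _.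
by rewrite wn (mulrC n%:R) mulrA.
Qed.

(** All empty windows coincide, so their frequency is one. Index [0] must be covered because
    [fekete] quantifies over all indices. *)
Lemma information0 (R : realType) (s : seq nat) : information R 0 s = 0.
Proof.
rewrite /information big_seq big1// => w ws.
have w0 := size0nil (size_mem_windows ws).
have cE : count_mem [::] (windows s 0) = size (windows s 0).
  apply/eqP; rewrite -all_count.
  by apply/allP => v /size_mem_windows/size0nil ->/=.
rewrite (emp_freqE R ws) w0 cE.
have : size (windows s 0) != 0%N by rewrite size_windows.
move=> sw; rewrite divff ?pnatr_eq0//.
by rewrite /log2 ln1 mul0r oppr0.
Qed.

Lemma information_rateE (R : realType) (r : nat) (w : nat -> seq nat) (l : nat) : words r w ->
  (information_rate R w l)%:E = limn_esup (fun n => (information R l (w n) / n%:R)%:E).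
Proof.
move=> hw; have [l0|l0] := posnP l.
  apply: (@limn_esup_EFin _ _ 0) => [n|]; first by rewrite divr_ge0 ?information_ge0.
  by apply: nearW => n; rewrite l0 information0 mul0r.
apply: (@limn_esup_EFin _ _ (l%:R * log2 r%:R)) => [n|].
  by rewrite divr_ge0 ?information_ge0.
by apply: nearW => n; exact: information_div_le.
Qed.

Lemma information_rate_near (R : realType) (r : nat) (w : nat -> seq nat) (l : nat) (e : R) :
  words r w -> 0 < e ->
  \forall n \near \oo, information R l (w n) / n%:R <= information_rate R w l + e.
Proof. by move=> hw; apply: limn_esup_near_le; rewrite (information_rateE R l hw). Qed.

Lemma information_rate_le (R : realType) (r : nat) (w : nat -> seq nat) (l : nat) (c : R) :
  words r w ->
  (forall e, 0 < e -> \forall n \near \oo, information R l (w n) / n%:R <= c + e) ->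
  information_rate R w l <= c.
Proof. by move=> hw h; rewrite -lee_fin (information_rateE R l hw); exact: limn_esup_le. Qed.

Lemma information_rate_ge0 (R : realType) (w : nat -> seq nat) (l : nat) :
  0 <= information_rate R w l.
Proof.
apply: fine_ge0; apply: limn_esup_ge0 => n.
by rewrite lee_fin divr_ge0 ?information_ge0.
Qed.

Lemma information_rateD (R : realType) (r : nat) (w : nat -> seq nat) (l m : nat) : words r w ->
  information_rate R w (l + m) <= information_rate R w l + information_rate R w m.
Proof.
move=> hw; apply: (information_rate_le hw) => e e0.
have e20 : 0 < e / 2 by rewrite divr_gt0.
near=> n; have n0 : (0 < n)%N by near: n; exact: near_ge1.
have hl : information R l (w n) / n%:R <= information_rate R w l + e / 2.
  by near: n; exact: (information_rate_near _ hw).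
have hm : information R m (w n) / n%:R <= information_rate R w m + e / 2.
  by near: n; exact: (information_rate_near _ hw).
have lmn : (l + m <= size (w n))%N.
  by have [-> _] := hw n; near: n; exists (l + m)%N.
have : information R (l + m) (w n) / n%:R <=
    information R l (w n) / n%:R + information R m (w n) / n%:R.
  by rewrite -mulrDl ler_pM2r ?invr_gt0 ?ltr0n// information_subadditive.
lra.
Unshelve. all: by end_near. Qed.

Lemma Hhat_l_ge0 (R : realType) (l : nat) (s : seq nat) : 0 <= Hhat_l l s :> R.
Proof.
rewrite Hhat_lE; apply: divr_ge0; first exact: information_ge0.
exact: mulr_ge0.
Qed.

(** The two sides differ by the ratio of [n - l + 1], the number of windows, to [n], which tends to
    one. *)
Lemma limn_esup_Hhat (R : realType) (r : nat) (w : nat -> seq nat) (l : nat) : words r w ->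
  (0 < l)%N ->
  limn_esup (fun n => (Hhat_l l (w n))%:E) = (information_rate R w l / l%:R)%:E.
Proof.
move=> hw l0; have lR : (0 : R) < l%:R by rewrite ltr0n.
have HE n : (0 < n)%N -> (l <= n)%N ->
    l%:R * (Hhat_l l (w n) : R) * (n%:R - l%:R + 1) = information R l (w n).
  move=> n0 ln; have [wn _] := hw n; rewrite Hhat_lE size_windows wn//.
  rewrite -natr1 natrB//; have : (0 : R) < n%:R - l%:R + 1.
    by rewrite ltr_wpDl// subr_ge0 ler_nat.
  by move=> nl0; field; rewrite !gt_eqF.
apply/eqP; rewrite eq_le; apply/andP; split.
  apply: limn_esup_le => e e0.
  have e20 : 0 < l%:R * (e / 2) by rewrite !mulr_gt0.
  (* For [n >= 2 l] at least half of the positions start a window, so [l * Hhat_l] is at most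
     [2 * (l * log2 r)]. Replacing [n - l + 1] by [n] changes the product by [l - 1] times this
     quantity, which [K] bounds. *)
  pose K : R := l%:R * (2 * (l%:R * log2 r%:R)).
  near=> n.
  have n0 : (0 < n)%N by near: n; exact: near_ge1.
  have ln : (l.*2 <= n)%N by near: n; exists l.*2.
  have nR : (0 : R) < n%:R by rewrite ltr0n.
  have h1 : information R l (w n) / n%:R <= information_rate R w l + l%:R * (e / 2).
    by near: n; exact: (information_rate_near _ hw).
  have h2 : K / n%:R <= l%:R * (e / 2) by near: n; exact: near_ler_inv.
  have h3 : information R l (w n) / n%:R <= l%:R * log2 r%:R.
    exact: information_div_le.
  have := HE n n0 (leq_trans (leq_addl l l) _); rewrite addnn => /(_ ln).
  set H : R := Hhat_l l (w n); set J := information R l (w n) => HJ.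
  have nl : (2 * l%:R : R) <= n%:R by rewrite -natrM ler_nat mul2n.
  have J0 : 0 <= J by exact: information_ge0.
  set N : R := n%:R - l%:R + 1; rewrite -/N in HJ.
  have N0 : 0 < N by rewrite /N; lra.
  have N2 : n%:R <= 2 * N by rewrite /N; lra.
  have l1R : (1 : R) <= l%:R by rewrite ler1n.
  have B0 : 0 <= l%:R * log2 r%:R :> R by apply: le_trans h3; rewrite divr_ge0.
  have xle : l%:R * H <= 2 * (l%:R * log2 r%:R).
    rewrite -(ler_pM2r N0) HJ; move: h3; rewrite ler_pdivrMr// => /le_trans; apply.
    by move: (l%:R * log2 _) B0 => B B0; nra.
  have lH : l%:R * H <= J / n%:R + K / n%:R.
    rewrite -mulrDl ler_pdivlMr//.
    have -> : l%:R * H * n%:R = J + l%:R * H * (l%:R - 1) by rewrite -HJ /N; ring.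
    rewrite lerD2l /K; have : 0 <= 2 * (l%:R * log2 r%:R) :> R by rewrite mulr_ge0.
    move: (l%:R * H) (2 * _) xle => x y xy y0.
    apply: (@le_trans _ _ (y * (l%:R - 1))); first by rewrite ler_wpM2r// subr_ge0.
    by rewrite mulrBr mulr1 mulrC gerDl oppr_le0.
  rewrite -(ler_pM2l lR).
  have -> : l%:R * (information_rate R w l / l%:R + e) = information_rate R w l + l%:R * e.
    by field; rewrite gt_eqF.
  rewrite -/J in h1; apply: le_trans lH _; apply: le_trans (lerD h1 h2) _.
  by rewrite le_eqVlt; apply/orP; left; apply/eqP; field.
case cE: (limn_esup _) => [c| |].
- rewrite lee_fin ler_pdivrMr//; apply: (information_rate_le hw) => e e0.
  have el0 : 0 < e / l%:R by rewrite divr_gt0.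
  near=> n; have n0 : (0 < n)%N by near: n; exact: near_ge1.
  have nR : (0 : R) < n%:R by rewrite ltr0n.
  have ln : (l <= n)%N by near: n; exists l.
  have Hc : Hhat_l l (w n) <= c + e / l%:R.
    by near: n; apply: limn_esup_near_le => //; rewrite cE.
  have lnR : (l%:R : R) <= n%:R by rewrite ler_nat.
  have l1R : (1 : R) <= l%:R by rewrite ler1n.
  rewrite -(HE n n0 ln) ler_pdivrMr//.
  (* In this direction no error term arises, since [n - l + 1 <= n]. *)
  apply: (@le_trans _ _ (l%:R * Hhat_l l (w n) * n%:R)).
    apply: ler_wpM2l; last by lra.
    by apply: mulr_ge0 => //; exact: Hhat_l_ge0.
  rewrite ler_pM2r// (_ : c * l%:R + e = l%:R * (c + e / l%:R)) ?ler_pM2l//.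
  by field; rewrite gt_eqF.
- by rewrite leey.
- suff : (0 <= limn_esup (fun n => (Hhat_l l (w n) : R)%:E))%E by rewrite cE.
  by apply: limn_esup_ge0 => n; rewrite lee_fin Hhat_l_ge0.
Unshelve. all: by end_near. Qed.

(** Fekete's lemma for the information rate: the outer limit in the definition of [Hhat_x] exists,
    and being an infimum it lies below each term. *)
Lemma Hhat_limit (R : realType) (r : nat) (w : nat -> seq nat) : words r w ->
  exists2 L : R, (fun l => limn_esup (fun n => (Hhat_l l (w n))%:E)) @ \oo --> L%:E &
    forall l, (0 < l)%N -> L <= information_rate R w l / l%:R.
Proof.
move=> hw.
have [L aL Lle] := fekete (information_rate_ge0 R w) (fun l m => information_rateD R l m hw).
exists L => //.
apply: cvg_EFin.
  near=> l; have l0 : (0 < l)%N by near: l; exact: near_ge1.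
  by rewrite (limn_esup_Hhat R hw l0).
apply: cvg_trans aL; apply: near_eq_cvg.
near=> l; have l0 : (0 < l)%N by near: l; exact: near_ge1.
by rewrite /= (limn_esup_Hhat R hw l0).
Unshelve. all: by end_near. Qed.

Lemma limn_esup_coding_le (R : realType) (r : nat) (w : nat -> seq nat)
    (Z : seq nat -> seq bool) (l : nat) : words r w -> @optimal_coding R Z -> (0 < l)%N ->
  (limn_esup (fun n => ((size (Z (w n)))%:R / n%:R : R)%:E) <=
   (information_rate R w l / l%:R)%:E)%E.
Proof.
move=> hw /(_ r _)/[swap] l0 /(_ _ l0)[f [f0 hf]].
apply: limn_esup_le => e e0; have e20 : 0 < e / 2 by rewrite divr_gt0.
near=> n; have [wn hr] := hw n.
have := hf _ hr; rewrite wn => /le_trans; apply.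
have h1 : f n / n%:R <= e / 2.
  have : `|f n / n%:R| <= e / 2.
    rewrite -normrN -sub0r; near: n; move/cvgrPdist_le : f0; exact.
  by apply: le_trans; exact: ler_norm.
have h2 : Hhat_l l (w n) <= information_rate R w l / l%:R + e / 2.
  by near: n; apply: limn_esup_near_le => //; rewrite (limn_esup_Hhat R hw).
lra.
Unshelve. all: by end_near. Qed.

(** * Birkhoff averages *)

Definition birkhoff_sum (R : realType) (X : Type) (T : X -> X) (g : X -> R) (n : nat) (x : X) : R :=
  \sum_(i < n) g (iter i T x).

Lemma birkhoff_sumD (R : realType) (X : Type) (T : X -> X) (g : X -> R) (n m : nat) (x : X) :
  birkhoff_sum T g (n + m) x = birkhoff_sum T g n x + birkhoff_sum T g m (iter n T x).
Proof.
rewrite /birkhoff_sum big_split_ord/=; congr (_ + _); apply: eq_bigr => i _.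
by rewrite addnC iterD.
Qed.

Lemma birkhoff_sum_ge0 (R : realType) (X : Type) (T : X -> X) (g : X -> R) (n : nat) (x : X) :
  (forall y, 0 <= g y) -> 0 <= birkhoff_sum T g n x.
Proof. by move=> g0; exact: sumr_ge0. Qed.

Lemma birkhoff_sum_le (R : realType) (X : Type) (T : X -> X) (g : X -> R) (K : R) (n : nat) (x : X) :
  (forall y, g y <= K) -> birkhoff_sum T g n x <= n%:R * K.
Proof.
move=> gK; rewrite mulr_natl -[n in leRHS]card_ord -sumr_const.
exact: ler_sum.
Qed.

Lemma measurable_iter d (X : measurableType d) (T : X -> X) (n : nat) :
  measurable_fun setT T -> measurable_fun setT (iter n T).
Proof.
move=> mT; elim: n => [|n ih]; first exact: measurable_id.
exact: (measurableT_comp mT ih).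
Qed.

Lemma measurable_birkhoff_sum d (X : measurableType d) (R : realType) (T : X -> X) (g : X -> R)
    (n : nat) : measurable_fun setT T -> measurable_fun setT g ->
  measurable_fun setT (birkhoff_sum T g n).
Proof.
move=> mT mg; apply: measurable_sum => i.
exact: (measurableT_comp mg (measurable_iter i mT)).
Qed.

Section maximal_inequality.
Context d (X : measurableType d) (R : realType) (mu : probability X R) (T : X -> X).
Hypothesis mT : measurable_fun setT T.
Hypothesis muT : forall B, measurable B -> mu (T @^-1` B) = mu B.

Lemma integral_cst1 (c : R) : (\int[mu]_x c%:E = c%:E)%E.
Proof.
rewrite integral_cst// [X in (_ * X)%E](_ : _ = 1%E) ?mule1//.
exact: probability_setT.
Qed.

Lemma integral_comp_invariant (f : X -> \bar R) : measurable_fun setT f ->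
  (forall x, 0 <= f x)%E -> (\int[mu]_x f (T x) = \int[mu]_x f x)%E.
Proof.
move=> mf f0; have := @ge0_integral_pushforward _ _ X X R T mT mu setT f measurableT mf (fun x _ => f0 x).
rewrite preimage_setT => <-; apply: eq_measure_integral => A mA _.
exact: muT.
Qed.

Lemma integral_iter_invariant (f : X -> \bar R) (n : nat) : measurable_fun setT f ->
  (forall x, 0 <= f x)%E -> (\int[mu]_x f (iter n T x) = \int[mu]_x f x)%E.
Proof.
move=> mf f0; elim: n => // n ih; rewrite -ih.
under eq_integral do rewrite iterSr.
apply: (@integral_comp_invariant (fun x => f (iter n T x))) => //.
exact: (measurableT_comp mf (measurable_iter n mT)).
Qed.

Lemma integral_birkhoff_sum (g : X -> R) (n : nat) : measurable_fun setT g ->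
  (forall x, 0 <= g x) ->
  (\int[mu]_x (birkhoff_sum T g n x)%:E = n%:R%:E * \int[mu]_x (g x)%:E)%E.
Proof.
move=> mg g0; under eq_integral do rewrite -sumEFin.
rewrite ge0_integral_sum//; [|move=> i|by move=> i x _; rewrite lee_fin].
  rewrite (eq_bigr (fun=> \int[mu]_x (g x)%:E)%E) => [|i _]; last first.
    apply: (@integral_iter_invariant (EFin \o g)); first exact/measurable_EFinP.
    by move=> x; rewrite lee_fin.
  by rewrite sumr_const card_ord mule_natl.
apply/measurable_EFinP; exact: (measurableT_comp mg (measurable_iter i mT)).
Qed.

Variables (g : X -> R) (K : R).
Hypothesis mg : measurable_fun setT g.
Hypothesis g0 : forall x, 0 <= g x.
Hypothesis gK : forall x, g x <= K.

Let S := birkhoff_sum T g.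
Let F x : R := fine (limn_esup (fun n => (S n x / n%:R)%:E)).

Let K0 : 0 <= K. Proof. exact: le_trans (g0 point) (gK point). Qed.

Let Sdiv_le x n : S n x / n%:R <= K.
Proof.
have [->|n0] := posnP n; first by rewrite invr0 mulr0.
by rewrite ler_pdivrMr ?ltr0n// mulrC birkhoff_sum_le.
Qed.

Let FE x : (F x)%:E = limn_esup (fun n => (S n x / n%:R)%:E).
Proof.
apply: (@limn_esup_EFin _ _ K) => [n|]; last by apply: nearW => n; exact: Sdiv_le.
by rewrite divr_ge0 ?birkhoff_sum_ge0.
Qed.

Let F0 x : 0 <= F x.
Proof.
rewrite -lee_fin FE; apply: limn_esup_ge0 => n.
by rewrite lee_fin divr_ge0 ?birkhoff_sum_ge0.
Qed.

Let FK x : F x <= K.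
Proof.
rewrite -lee_fin FE; apply: limn_esup_le => e e0; apply: nearW => n.
by apply: le_trans (Sdiv_le x n) _; rewrite lerDl ltW.
Qed.

Let F_le x y : (forall n, S n x <= S n y + K) -> F x <= F y.
Proof.
move=> xy; rewrite -lee_fin !FE; apply: (@le_limn_esup_error _ _ _ K) => n.
  by rewrite divr_ge0 ?birkhoff_sum_ge0.
by rewrite -mulrDl ler_wpM2r.
Qed.

(** The sums [S m y] and [S m (T y)] differ by one value of [g] at each end, hence by at most
    [K]. *)
Let F_invariant x n : F (iter n T x) = F x.
Proof.
elim: n => // n ih; rewrite -ih iterS; move: (iter n T x) => y {x ih}.
have ST m : g y + S m (T y) = S m y + g (iter m T y).
  have := birkhoff_sumD T g 1 m y; rewrite {2}/birkhoff_sum big_ord1/= => <-.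
  rewrite addnC birkhoff_sumD; congr (_ + _).
  by rewrite /birkhoff_sum big_ord1.
apply/eqP; rewrite eq_le; apply/andP; split; apply: F_le => m.
  by have := ST m; have := g0 y; have := gK (iter m T y); lra.
by have := ST m; have := gK y; have := g0 (iter m T y); lra.
Qed.

Let mF : measurable_fun setT F.
Proof.
apply/measurable_EFinP; rewrite (_ : EFin \o F =
    (fun x => limn_esup (fun n => (S n x / n%:R)%:E))); last first.
  by apply/funext => x; rewrite /= FE.
apply: measurable_fun_limn_esup => n; apply/measurable_EFinP.
by apply: measurable_funM => //; exact: measurable_birkhoff_sum.
Qed.

Section exceptional_set.
Variable e : R.
Hypothesis e0 : 0 < e.

(** The exceptional set of the Katznelson-Weiss argument: points at which no good block of length at
    most [M] begins. *)
Let E (M : nat) := [set x | forall n, (0 < n <= M)%N -> S n x < n%:R * (F x - e)].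

Let mE M : measurable (E M).
Proof.
have -> : E M = \bigcap_(n in [set n | (0 < n <= M)%N])
    [set x | S n x < n%:R * (F x - e)].
  by apply/seteqP; split => x /= h n; exact: h.
apply: bigcap_measurableType => n _.
pose h x := S n x - n%:R * (F x - e).
rewrite (_ : [set _ | _] = setT `&` h @^-1` `]-oo, 0[%classic); last first.
  by apply/seteqP; split => x /=; rewrite in_itv/= subr_lt0 => // -[].
have mh : measurable_fun setT h.
  apply: measurable_funB; first exact: measurable_birkhoff_sum.
  by apply: measurable_funM => //; exact: measurable_funB.
exact: mh.
Qed.

(** The sets decrease, and a point in all of them would have every average below [F x - e], against
    the definition of [F x] as their limsup. *)
Let muE : (mu (E M) @[M --> \oo] --> 0)%E.
Proof.
have -> : (0 = mu (\bigcap_M E M))%E.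
  rewrite (_ : \bigcap_M E M = set0) ?measure0//.
  apply/seteqP; split => // x Ex.
  suff : F x <= F x - e / 2 by move: e0; lra.
  rewrite -lee_fin {1}FE; apply: limn_esup_le => e' e'0; near=> n.
  have n0 : (0 < n)%N by near: n; exact: near_ge1.
  have := Ex n I n; rewrite n0 leqnn => /(_ isT).
  by rewrite mulrC -ltr_pdivrMr ?ltr0n// => h; move: e0 e'0 h; lra.
apply: nonincreasing_cvg_mu => //.
- by rewrite -ge0_fin_numE ?fin_num_measure.
- exact: bigcap_measurableType.
- move=> m n mn; apply/subsetPset => x Ex k /andP[k0 km].
  by apply: Ex; rewrite k0 (leq_trans km).
Unshelve. all: by end_near. Qed.

(* Along an orbit outside [E M], blocks of length at most [M] on which the
   average of [g] exceeds [F x - e] follow each other; points of [E M] are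
   blocks of length one because [g + K * \1_(E M)] is at least [K] there. *)
Let block_decomposition M L x : (0 < M)%N ->
  L%:R * (F x - e) - M%:R * K <= birkhoff_sum T (fun y => g y + K * \1_(E M) y) L x.
Proof.
move=> M0; set g' := fun y => _.
have gg' y : g y <= g' y by rewrite lerDl mulr_ge0.
have g'0 y : 0 <= g' y by rewrite (le_trans _ (gg' y)).
elim/ltn_ind: L x => L ih x; have [LM|ML] := leqP L M.
  (* The unfinished last block is paid for by [M * K]: here the left side is already nonpositive. *)
  apply: (@le_trans _ _ 0); last exact: birkhoff_sum_ge0.
  have : L%:R * (F x - e) <= L%:R * K by rewrite ler_wpM2l//; have := FK x; move: e0; lra.
  have : (L%:R * K <= M%:R * K :> R) by rewrite ler_wpM2r// ler_nat.
  lra.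
(* A good block is put in front of the decomposition from [iter n T x], where [F] has the same
   value. *)
have block n : (0 < n <= L)%N -> n%:R * (F x - e) <= birkhoff_sum T g' n x ->
    L%:R * (F x - e) - M%:R * K <= birkhoff_sum T g' L x.
  move=> /andP[n0 nL] h; have := ih (L - n)%N _ (iter n T x).
  rewrite F_invariant natrB// => /(_ ltac:(lia)) h2.
  rewrite -(subnKC nL) birkhoff_sumD subnKC//; move: h2.
  rewrite mulrBl; lra.
have [xE|xE] := pselect (E M x).
  apply: (block 1%N); first by lia.
  rewrite mul1r /birkhoff_sum big_ord1/= /g' indicE mem_set//= mulr1.
  have := FK x; have := g0 x; move: e0; lra.
have [n nM nS] : exists2 n, (0 < n <= M)%N & n%:R * (F x - e) <= S n x.
  apply: contrapT => h; apply: xE => n nM; rewrite ltNge; apply/negP => h2.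
  by apply: h; exists n.
apply: (block n); first by lia.
by apply: le_trans nS _; exact: ler_sum.
Qed.

Let integral_fin (f : X -> R) (c : R) : measurable_fun setT f -> (forall x, 0 <= f x) ->
  (forall x, f x <= c) -> (fine (\int[mu]_x (f x)%:E))%:E = (\int[mu]_x (f x)%:E)%E.
Proof.
move=> mf f0 fc; rewrite fineK// ge0_fin_numE; last first.
  by apply: integral_ge0 => x _; rewrite lee_fin.
apply: (@le_lt_trans _ _ (\int[mu]_x c%:E)%E).
  apply: ge0_le_integral => //; [by move=> x _; rewrite lee_fin|exact/measurable_EFinP|].
  by move=> x _; rewrite lee_fin.
by rewrite integral_cst1 ltry.
Qed.

(** Integrate [block_decomposition] and divide by [L]. The error [K * e] is the mass added on [E M],
    one [e] is the slack in [F x - e], and the other bounds [M * K / L]. *)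
Lemma integral_limn_esup_birkhoff_le_eps :
  (\int[mu]_x limn_esup (fun n => (birkhoff_sum T g n x / n%:R)%:E) <=
   \int[mu]_x (g x)%:E + (K * e + 2 * e)%:E)%E.
Proof.
under eq_integral do rewrite -FE.
have [M M0 ME] : exists2 M, (0 < M)%N & (mu (E M) <= e%:E)%E.
  have : (\forall M \near \oo, mu (E M) < e%:E)%E.
    suff /muE : nbhs (0%:E : \bar R) [set y | y < e%:E]%E by [].
    by apply: open_ereal_lt'; rewrite lte_fin.
  move=> h; have [M [M0 ME]] := filter_ex (filterI near_ge1 h).
  by exists M => //; exact: ltW.
pose g' y := g y + K * \1_(E M) y.
have mg' : measurable_fun setT g'.
  by apply: measurable_funD => //; apply: measurable_funM => //; exact: measurable_indic.
have g'0 y : 0 <= g' y by rewrite addr_ge0// mulr_ge0.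
have g'int : (\int[mu]_x (g' x)%:E <= \int[mu]_x (g x)%:E + (K * e)%:E)%E.
  under eq_integral do rewrite EFinD.
  rewrite ge0_integralD//; [|by move=> x _; rewrite lee_fin|exact/measurable_EFinP|
    by move=> x _; rewrite lee_fin mulr_ge0|].
    rewrite leeD2l//; under eq_integral do rewrite EFinM.
    rewrite ge0_integralZl_EFin//.
      by rewrite integral_indic// setIT EFinM lee_wpmul2l// lee_fin.
    by apply/measurable_EFinP; exact: measurable_indic.
  by apply/measurable_EFinP; apply: measurable_funM => //; exact: measurable_indic.
have main L : (L%:R%:E * \int[mu]_x (F x)%:E <=
    L%:R%:E * \int[mu]_x (g' x)%:E + (L%:R * e + M%:R * K)%:E)%E.
  rewrite -ge0_integralZl_EFin//; [|by move=> x _; rewrite lee_fin|exact/measurable_EFinP].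
  rewrite -integral_birkhoff_sum//.
  have c0 : 0 <= L%:R * e + M%:R * K by rewrite addr_ge0 ?mulr_ge0// ltW.
  have -> : ((L%:R * e + M%:R * K)%:E = \int[mu]_x (L%:R * e + M%:R * K)%:E)%E.
    by rewrite integral_cst1.
  have mS : measurable_fun setT (fun x => (birkhoff_sum T g' L x)%:E).
    by apply/measurable_EFinP; exact: measurable_birkhoff_sum.
  rewrite -ge0_integralD//; last by move=> x _; rewrite lee_fin birkhoff_sum_ge0.
  apply: ge0_le_integral => //.
  - by move=> x _; rewrite lee_fin mulr_ge0.
  - by apply/measurable_EFinP; apply: measurable_funM.
  - exact: emeasurable_funD.
  - move=> x _; rewrite -EFinD lee_fin.
    by have := block_decomposition L x M0; rewrite -/g'; lra.
have g'c y : g' y <= K + K.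
  by rewrite lerD// ler_piMr// indicE; case: (_ \in _).
move: main g'int; rewrite -(integral_fin mg g0 gK) -(integral_fin mg' g'0 g'c) -(integral_fin mF F0 FK).
move: (fine _) (fine _) (fine _) => a b c.
rewrite -!EFinD !lee_fin => main bc.
have MK0 : 0 <= M%:R * K by rewrite mulr_ge0.
have [L /=] : exists L : nat, (0 < L)%N /\ M%:R * K / L%:R <= e.
  exact: (filter_ex (filterI near_ge1 (near_ler_inv (M%:R * K) e0))).
move=> [L0]; rewrite ler_pdivrMr ?ltr0n// => LMK.
have := main L; rewrite -!EFinM -EFinD lee_fin => h.
have LR : (0 : R) < L%:R by rewrite ltr0n.
rewrite -(ler_pM2l LR); nra.
Qed.

End exceptional_set.

(** The upper half of the ergodic theorem, without convergence of the averages. Taking [e / (K + 2)]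
    in the previous bound makes the total error [e]. *)
Theorem integral_limn_esup_birkhoff_le :
  (\int[mu]_x limn_esup (fun n => (birkhoff_sum T g n x / n%:R)%:E) <= \int[mu]_x (g x)%:E)%E.
Proof.
apply/lee_addgt0Pr => e e0.
have K2 : 0 < K + 2 by rewrite ltr_wpDl.
have := integral_limn_esup_birkhoff_le_eps (divr_gt0 e0 K2).
by rewrite -mulrDl mulrC divfK// gt_eqF.
Qed.

End maximal_inequality.

(** * Expected code lengths *)

(* At most [2 ^ m] binary words have length [m]. *)
Lemma sum_code_weights_le (R : realType) (I : finType) (f : I -> seq bool) (N : nat) :
  injective f -> (forall i, size (f i) <= N)%N ->
  \sum_i (2^-1 : R) ^+ size (f i) <= N.+1%:R.
Proof.
move=> f_inj fN.
have fibre (m : 'I_N.+1) : \sum_(i | size (f i) == m) (2^-1 : R) ^+ size (f i) <= 1.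
  rewrite (eq_bigr (fun=> 2^-1 ^+ m)) => [|i /eqP-> //].
  rewrite sumr_const exprVn -[_ *+ _]mulr_natl ler_pdivrMr ?exprn_gt0// mul1r -natrX ler_nat.
  (* The default tuple is never taken on indices whose code has length [m]. *)
  pose g i : m.-tuple bool := insubd (nseq_tuple m false) (f i).
  have g_inj : {in [pred i | size (f i) == m] &, injective g}.
    move=> i j; rewrite !inE => im jm /(congr1 val).
    by rewrite !val_insubd im jm => /f_inj.
  rewrite -(card_in_image g_inj); apply: leq_trans (max_card _) _.
  by rewrite card_tuple card_bool.
rewrite (partition_big (fun i => inord (size (f i)) : 'I_N.+1) xpredT)//=.
rewrite -[N.+1 in leRHS]card_ord -sumr_const; apply: ler_sum => m _.
apply: le_trans (fibre m); rewrite le_eqVlt; apply/orP; left; apply/eqP.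
by apply: eq_bigl => i; rewrite -val_eqE/= inordK// ltnS.
Qed.

(** Reverse Fatou lemma. The tail suprema converge to the limsup and are dominated by the constant
    [B], so their integrals converge to [a]; each [f n] lies below its tail supremum. *)
Lemma limn_esup_integral_le d (X : measurableType d) (R : realType) (mu : probability X R)
    (f : nat -> X -> R) (B : R) (N : nat) :
  (forall n, measurable_fun setT (f n)) -> (forall n x, 0 <= f n x) ->
  (forall n x, (N <= n)%N -> f n x <= B) ->
  exists2 a : R, (\int[mu]_x limn_esup (fun n => (f n x)%:E) = a%:E)%E &
    forall e, 0 < e -> \forall n \near \oo, (\int[mu]_x (f n x)%:E <= (a + e)%:E)%E.
Proof.
move=> mf f0 fB.
have B0 : 0 <= B by exact: le_trans (f0 N point) (fB N point (leqnn N)).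
(* The bound [B] holds only from index [N] on; earlier suprema are replaced by zero to keep the
   domination. *)
pose F n x := if (N <= n)%N then esups (fun k => (f k x)%:E) n else 0%E.
have F0 n x : (0 <= F n x)%E.
  rewrite /F; case: ifP => // _; apply: (@le_trans _ _ (f n x)%:E).
    by rewrite lee_fin.
  by apply: ereal_sup_ubound; exists n => /=.
have FB n x : (F n x <= B%:E)%E.
  rewrite /F; case: ifP => [Nn|_]; last by rewrite lee_fin.
  by apply: ge_ereal_sup => _ [k /= nk <-]; rewrite lee_fin fB// (leq_trans Nn).
have mEf n : measurable_fun setT (fun x => (f n x)%:E) by exact/measurable_EFinP.
have mF n : measurable_fun setT (F n).
  rewrite /F; case: (N <= n)%N; last exact: measurable_cst.
  exact: measurable_fun_esups.
have Fcvg x : (F ^~ x @ \oo --> limn_esup (fun n => (f n x)%:E))%E.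
  rewrite limn_esup_lim; have := @is_cvg_esups R (fun n => (f n x)%:E).
  apply: cvg_trans.
  by apply: near_eq_cvg; exists N => // n /= Nn; rewrite /F Nn.
have := @dominated_cvg _ X R mu setT measurableT F _ (fun=> B%:E) mF (fun x _ => Fcvg x).
have lim_ge0 : (0 <= \int[mu]_x limn_esup (fun n => (f n x)%:E))%E.
  by apply: integral_ge0 => x _; apply: limn_esup_ge0 => n; rewrite lee_fin.
have lim_le : (\int[mu]_x limn_esup (fun n => (f n x)%:E) <= B%:E)%E.
  rewrite -(integral_cst1 mu B); apply: ge0_le_integral => //.
  - by move=> x _; apply: limn_esup_ge0 => n; rewrite lee_fin.
  - exact: measurable_fun_limn_esup.
  - move=> x _; apply: limn_esup_le => e e0; exists N => // n /= Nn.
    by apply: le_trans (fB n x Nn) _; rewrite lerDl ltW.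
case aE: (\int[mu]_x limn_esup _)%E lim_ge0 lim_le => [a| |]//= _ _ h.
exists a => // e e0.
have {}h : (\int[mu]_x F n x @[n --> \oo] --> a%:E)%E.
  apply: h => //.
    by apply: finite_measure_integrable_cst.
  by move=> n x _; rewrite gee0_abs// F0.
have : \forall n \near \oo, (\int[mu]_x F n x < (a + e)%:E)%E.
  suff /h : nbhs (a%:E : \bar R) [set y | y < (a + e)%:E]%E by [].
  by apply: open_ereal_lt'; rewrite lte_fin ltrDl.
move=> {}h; near=> n; have Nn : (N <= n)%N by near: n; exists N.
apply: (@le_trans _ _ (\int[mu]_x F n x)%E); last first.
  by apply: ltW; near: n; exact: h.
apply: ge0_le_integral => //; first by move=> x _; rewrite lee_fin.
by move=> x _; rewrite /F Nn; apply: ereal_sup_ubound; exists n => /=.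
Unshelve. all: by end_near. Qed.

(** * Itineraries *)

(** The shift by one matches [part_symbol], which keeps [0] for points outside every cell. *)
Definition word_of (r n : nat) (w : n.-tuple 'I_r) : seq nat := [seq (val i).+1 | i <- w].

Lemma size_word_of (r n : nat) (w : n.-tuple 'I_r) : size (word_of w) = n.
Proof. by rewrite size_map size_tuple. Qed.

Lemma word_of_inj (r n : nat) : injective (@word_of r n).
Proof. by move=> v w /inj_map vw; apply: val_inj; apply: vw => i j [] /val_inj. Qed.

Lemma word_of_symbols (r n : nat) (w : n.-tuple 'I_r) :
  all (fun a => (1 <= a <= r)%N) (word_of w).
Proof. by apply/allP => a /mapP[i _ ->] /=. Qed.

(** The formula of [H_join] over an arbitrary measurable space instead of the Borel sets of a
    topological one. *)
Definition word_entropy d (X : measurableType d) (R : realType) (mu : probability X R)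
    (T : X -> X) (r : nat) (A : 'I_r -> set X) (n : nat) : R :=
  - \sum_(w : n.-tuple 'I_r)
      fine (mu (cylinder T A w)) * log2 (fine (mu (cylinder T A w))).

Section symbolic_dynamics.
Context d (X : measurableType d) (R : realType) (mu : probability X R) (T : X -> X).
Hypothesis mT : measurable_fun setT T.
Hypothesis muT : forall B, measurable B -> mu (T @^-1` B) = mu B.
Context (r : nat) (A : 'I_r -> set X).
Hypothesis mA : forall i, measurable (A i).
Hypothesis disjA : forall i j, i != j -> A i `&` A j = set0.
Hypothesis coverA : \bigcup_(i in [set: 'I_r]) A i = [set: X].

Let word x n := itinerary T A x n.

Let cellE y i : A i y -> part_symbol A y = (val i).+1.
Proof.
move=> Ay; rewrite /part_symbol; case: pselect => [h|[]]; last by exists i.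
case: cid => j /= Aj; congr (val _).+1; apply/eqP; apply: contrapT => /negP ji.
have : (A j `&` A i) y by [].
by rewrite disjA.
Qed.

Let cell y : {i | A i y}.
Proof.
apply: cid; have : [set: X] y by [].
by rewrite -coverA => -[i _ Ay]; exists i.
Qed.

Lemma partition_nonempty : (0 < r)%N.
Proof. by case: (cell point) => i _; exact: leq_ltn_trans (ltn_ord i). Qed.

Let wordE x n : word x n = word_of [tuple projT1 (cell (iter j T x)) | j < n].
Proof.
rewrite /word /itinerary /word_of /= -map_comp -val_enum_ord -map_comp.
by apply: eq_map => j /=; case: cell => i /= /cellE.
Qed.

Lemma words_itinerary x : words r (itinerary T A x).
Proof. by move=> n; rewrite -/(word x n) wordE size_word_of word_of_symbols. Qed.

Lemma cylinderE n (w : n.-tuple 'I_r) :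
  cylinder T A w = [set x | itinerary T A x n = word_of w].
Proof.
apply/seteqP; split => x /=; rewrite -/(word x n) wordE.
  move=> Aw; congr word_of; apply: eq_from_tnth => j; rewrite tnth_mktuple.
  case: cell => i /= Ai; apply: val_inj; apply: succn_inj.
  by rewrite -(cellE Ai) (cellE (Aw j)).
move=> /word_of_inj <- j; rewrite tnth_mktuple.
by case: cell.
Qed.

Lemma measurable_cylinder n (w : n.-tuple 'I_r) : measurable (cylinder T A w).
Proof.
rewrite (_ : cylinder T A w = \bigcap_k
    [set x | forall j : 'I_n, val j = k -> A (tnth w j) (iter j T x)]); last first.
  by apply/seteqP; split => x Ax => [k _ j _|j]; [exact: Ax|exact: (Ax j)].
apply: bigcap_measurableType => k _; have [kn|nk] := ltnP k n; last first.
  rewrite (_ : [set _ | _] = setT)//; apply/seteqP; split => // x _ j jk.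
  by have := ltn_ord j; rewrite jk ltnNge nk.
rewrite (_ : [set _ | _] = setT `&` iter k T @^-1` A (tnth w (Ordinal kn))).
  exact: measurable_iter.
apply/seteqP; split => x /= => [Ax|[_ Ax] j jk].
  by split => //; exact: (Ax (Ordinal kn)).
by rewrite (_ : j = Ordinal kn)//; exact: val_inj.
Qed.

Let p n (w : n.-tuple 'I_r) : R := fine (mu (cylinder T A w)).

Let p_ge0 n (w : n.-tuple 'I_r) : 0 <= p w.
Proof. exact: fine_ge0. Qed.

(** A function of the first [n] symbols is a finite combination of indicators of cylinders, which
    yields both its measurability and its integral. *)
Let itinerary_sum (phi : seq nat -> R) n x :
  phi (itinerary T A x n) = \sum_(w : n.-tuple 'I_r) phi (word_of w) * \1_(cylinder T A w) x.
Proof.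
rewrite -/(word x n) wordE; set v := mktuple _.
rewrite (bigD1 v)//= big1 => [|w wv].
  rewrite addr0 indicE mem_set ?mulr1// cylinderE/= -/(word x n) wordE.
  by [].
rewrite indicE memNset ?mulr0// cylinderE/= -/(word x n) wordE => /word_of_inj vw.
by rewrite -vw eqxx in wv.
Qed.

Lemma measurable_itinerary (phi : seq nat -> R) n :
  measurable_fun setT (fun x => phi (itinerary T A x n)).
Proof.
under eq_fun do rewrite itinerary_sum.
apply: measurable_sum => w; apply: measurable_funM => //.
exact/measurable_indic/measurable_cylinder.
Qed.

Lemma integral_itinerary (phi : seq nat -> R) n : (forall s, 0 <= phi s) ->
  (\int[mu]_x (phi (itinerary T A x n))%:E =
   (\sum_(w : n.-tuple 'I_r) phi (word_of w) * fine (mu (cylinder T A w)))%:E)%E.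
Proof.
move=> phi0; under eq_integral do rewrite itinerary_sum -sumEFin.
have m1 (w : n.-tuple 'I_r) : measurable_fun setT (fun x => (\1_(cylinder T A w) x : R)).
  exact/measurable_indic/measurable_cylinder.
rewrite ge0_integral_sum//; last 2 first.
- by move=> w; apply/measurable_EFinP; exact: measurable_funM.
- by move=> w x _; rewrite lee_fin mulr_ge0.
rewrite -sumEFin; apply: eq_bigr => w _; under eq_integral do rewrite EFinM.
rewrite ge0_integralZl_EFin//; last exact/measurable_EFinP.
have mw := measurable_cylinder w.
by rewrite integral_indic// setIT EFinM fineK// fin_num_measure.
Qed.

Let sum_p n : \sum_(w : n.-tuple 'I_r) p w = 1.
Proof.
have := @integral_itinerary (fun=> 1) n (fun=> ler01).
rewrite integral_cst1 => -[]; under eq_bigr do rewrite mul1r.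
by [].
Qed.

(** Gibbs' inequality with the weights [2 ^ - size (g w)]. The code is injective but perhaps not
    prefix-free, so the weights may sum to as much as [N + 1], whence the logarithmic term. *)
Lemma word_entropy_le_code n (f : seq nat -> nat) (g : n.-tuple 'I_r -> seq bool) (N : nat) :
  injective g -> (forall w, size (g w) = f (word_of w)) -> (forall w, (size (g w) <= N)%N) ->
  ((word_entropy mu T A n)%:E <=
   \int[mu]_x ((f (itinerary T A x n))%:R : R)%:E + (log2 N.+1%:R)%:E)%E.
Proof.
move=> g_inj gf gN; rewrite (@integral_itinerary (fun s => (f s)%:R))//.
rewrite -EFinD lee_fin.
have q0 (w : n.-tuple 'I_r) : (0 : R) < 2^-1 ^+ size (g w) by rewrite exprn_gt0.
have := gibbs (@p_ge0 n) q0 (sum_p n) (ltr0Sn R N) (sum_code_weights_le R g_inj gN).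
move=> /le_trans; apply; rewrite lerD2r le_eqVlt; apply/orP; left; apply/eqP.
apply: eq_bigr => w _; rewrite log2Xn// log2V// log2_2 mulrN1 opprK gf.
by rewrite mulrC.
Qed.

Let r_gt0 : (0 : R) < r%:R. Proof. by rewrite ltr0n partition_nonempty. Qed.

Let windows_itinerary l n x : (l <= n)%N -> windows (itinerary T A x n) l =
  [seq itinerary T A (iter i T x) l | i <- iota 0 (n - l).+1].
Proof.
move=> ln; rewrite /windows size_map size_iota ln; apply/eq_in_map => i.
rewrite mem_iota/= => il; rewrite /itinerary -map_drop -map_take.
rewrite drop_iota take_iota add0n (minn_idPl _); last by lia.
rewrite -[i in iota i]addn0 iotaDl -map_comp; apply: eq_map => j /=.
by rewrite addnC iterD.
Qed.

(* The code with lengths [- log2 q], where [q] is the mean of the law of words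
   of length [l] and of the uniform law: it is bounded, and costs at most one
   bit more than the optimal one. *)
Let q l (s : seq nat) : R :=
  (fine (mu [set x | itinerary T A x l = s]) + (r%:R^-1) ^+ l) / 2.

Let u_gt0 l : (0 : R) < r%:R^-1 ^+ l.
Proof. by rewrite exprn_gt0// invr_gt0. Qed.

Let q_gt0 l s : 0 < q l s.
Proof. by rewrite divr_gt0// ltr_wpDl// fine_ge0. Qed.

Let q_word l (w : l.-tuple 'I_r) : q l (word_of w) = (p w + r%:R^-1 ^+ l) / 2.
Proof. by rewrite /q -cylinderE. Qed.

Let sum_q l : \sum_(w : l.-tuple 'I_r) q l (word_of w) = 1.
Proof.
under eq_bigr do rewrite q_word.
rewrite -mulr_suml big_split/= sum_p sumr_const card_tuple card_ord.
rewrite -[_ *+ _]mulr_natl natrX -exprMn divff ?gt_eqF// expr1n.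
by rewrite -[1 + 1]/(2%:R) divff.
Qed.

Let q_le1 l x : q l (itinerary T A x l) <= 1.
Proof.
rewrite -/(word x l) wordE; set v := mktuple _; rewrite -(sum_q l) (bigD1 v)//= lerDl.
by rewrite sumr_ge0// => w _; exact: ltW.
Qed.

Let code_length l x : R := - log2 (q l (itinerary T A x l)).

(** The [l]-windows of an itinerary are the initial words of the iterates of [x], so coding them by
    [q] costs a Birkhoff sum. The last [l - 1] iterates start no window and only add nonnegative
    terms. *)
Let information_le_birkhoff l n x : (0 < l)%N ->
  information R l (itinerary T A x n) <= birkhoff_sum T (code_length l) n x.
Proof.
move=> l0; have c0 y : 0 <= code_length l y by rewrite oppr_ge0 log2_le0.
have [nl|ln] := ltnP n l.
  rewrite /information /windows size_map size_iota leqNgt nl big_nil.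
  exact: birkhoff_sum_ge0.
apply: (le_trans (information_le (@q_gt0 l) _)).
  rewrite -(sum_q l) -[leRHS]big_enum/= -(big_map (@word_of r l) xpredT (q l)).
  apply: ler_sum_sub_uniq; [by move=> s; exact: ltW|exact: undup_uniq|].
  move=> s; rewrite mem_undup windows_itinerary// => /mapP[i _ ->].
  by rewrite -/(word _ _) wordE map_f// mem_enum.
rewrite windows_itinerary// big_map /birkhoff_sum.
have -> : \sum_(i <- iota 0 (n - l).+1) - log2 (q l (itinerary T A (iter i T x) l)) =
    \sum_(0 <= i < (n - l).+1) code_length l (iter i T x).
  by rewrite /index_iota subn0.
rewrite -(big_mkord xpredT (fun i => code_length l (iter i T x))).
rewrite [leRHS](@big_cat_nat _ _ _ (n - l).+1)//=; last by lia.
by rewrite lerDl sumr_ge0.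
Qed.

(** Since [q] is at least half the law of words, each code length exceeds the ideal one by at most
    one bit. *)
Let integral_code_length l :
  (\int[mu]_x (code_length l x)%:E <= (word_entropy mu T A l + 1)%:E)%E.
Proof.
(* [integral_itinerary] asks for nonnegativity on all sequences, while [q_le1] gives it only on
   itineraries. *)
pose phi s : R := Num.max 0 (- log2 (q l s)).
under eq_integral => x _.
  rewrite (_ : code_length l x = phi (itinerary T A x l)); last first.
    by rewrite /phi max_r// oppr_ge0 log2_le0.
  over.
rewrite integral_itinerary; last by move=> s; rewrite /phi le_max lexx.
rewrite lee_fin /word_entropy -sumrN -(sum_p l) -big_split/=.
apply: ler_sum => w _; rewrite -/(p w).
have [p0|p0] := eqVneq (p w) 0; first by rewrite p0 !mulr0 !mul0r oppr0 addr0.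
have pw : 0 < p w by rewrite lt_neqAle eq_sym p0 p_ge0.
(* A word of positive measure is an itinerary, so the maximum in [phi] may be removed there. *)
have [x xw] : exists x, itinerary T A x l = word_of w.
  apply: contrapT => h; move: p0; rewrite /p cylinderE.
  rewrite (_ : [set _ | _] = set0) ?measure0 ?eqxx//.
  by apply/seteqP; split => // x /= xw; apply: h; exists x.
rewrite /phi -xw max_r ?oppr_ge0 ?log2_le0// xw q_word.
have mono : log2 (p w) <= log2 (p w + r%:R^-1 ^+ l) by rewrite ler_log2// lerDl ltW.
have lengthE : - log2 ((p w + r%:R^-1 ^+ l) / 2) = 1 - log2 (p w + r%:R^-1 ^+ l).
  by rewrite log2M ?invr_gt0// ?addr_gt0// log2V// log2_2; ring.
have key : - log2 ((p w + r%:R^-1 ^+ l) / 2) <= 1 - log2 (p w) by rewrite lengthE lerB.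
rewrite mulrC; apply: le_trans (ler_wpM2l (ltW pw) key) _.
by rewrite mulrBr mulr1 addrC.
Qed.

Lemma integral_information_le l : (0 < l)%N ->
  (\int[mu]_x limn_esup (fun n => (information R l (itinerary T A x n) / n%:R)%:E) <=
   (word_entropy mu T A l + 1)%:E)%E.
Proof.
move=> l0; have c0 y : 0 <= code_length l y by rewrite oppr_ge0 log2_le0.
have cK y : code_length l y <= - log2 (r%:R^-1 ^+ l / 2).
  rewrite lerN2 ler_log2 ?divr_gt0// ler_pM2r// lerDr.
  exact: fine_ge0.
have mc : measurable_fun setT (code_length l).
  exact: (@measurable_itinerary (fun s => - log2 (q l s))).
apply: le_trans (integral_code_length l).
apply: le_trans (integral_limn_esup_birkhoff_le mT muT mc c0 cK).
apply: ge0_le_integral => //.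
- move=> x _; apply: limn_esup_ge0 => n.
  by rewrite lee_fin divr_ge0 ?information_ge0.
- apply: measurable_fun_limn_esup => n; apply/measurable_EFinP.
  exact: (@measurable_itinerary (fun s => information R l s / n%:R)).
- apply: measurable_fun_limn_esup => n; apply/measurable_EFinP.
  by apply: measurable_funM => //; exact: measurable_birkhoff_sum.
- move=> x _; apply: le_limn_esup; apply: nearW => n.
  by rewrite lee_fin ler_wpM2r// information_le_birkhoff.
Qed.

End symbolic_dynamics.

(** * Equality of the integrals *)

Lemma Hhat_1_le (R : realType) (r : nat) (s : seq nat) : (0 < size s)%N ->
  all (fun a => (1 <= a <= r)%N) s -> Hhat_l 1 s <= log2 r%:R :> R.
Proof.
move=> s0 hs; rewrite Hhat_lE mul1r size_windows// subn1 prednK//.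
by rewrite ler_pdivrMr ?ltr0n// mulrC information1_le.
Qed.

(** This supplies the domination for reverse Fatou and bounds the program lengths in Gibbs'
    inequality. It combines [AIC_le_coding] with optimality for windows of length one. *)
Lemma near_AIC_le (R : realType) (C : seq bool -> option (seq nat)) (Z : seq nat -> seq bool)
    (r : nat) : universal_machine C -> reversible_coding Z -> @optimal_coding R Z ->
  exists B N : nat, forall n s, (N <= n)%N -> size s = n ->
    all (fun a => (1 <= a <= r)%N) s -> (AIC C s <= B * n)%N.
Proof.
move=> hC hZ /(_ r 1%N isT)[f [f0 hf]].
have [c hc] := AIC_le_coding hC hZ.
(* The [2] covers [f n / n] and [c / n], each eventually at most one. *)
have [B hB] : exists B : nat, log2 r%:R + 2 <= B%:R :> R.
  exact: (filter_ex (nbhs_infty_ger (log2 r%:R + 2 : R))).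
exists B; suff [N _ hN] : \forall n \near \oo, forall s, size s = n ->
    all (fun a => (1 <= a <= r)%N) s -> (AIC C s <= B * n)%N.
  by exists N => n s Nn; exact: hN.
near=> n => s sn hs; have n0 : (0 < n)%N by near: n; exact: near_ge1.
have nR : (0 : R) < n%:R by rewrite ltr0n.
have h1 : f n / n%:R <= 1.
  have : `|f n / n%:R| <= 1.
    rewrite -normrN -sub0r; near: n; move/cvgrPdist_le : f0; apply; exact: ltr01.
  by apply: le_trans; exact: ler_norm.
have h2 : c%:R / n%:R <= 1 :> R by near: n; exact: near_ler_inv.
have := hf s hs; rewrite sn => h3.
have h4 : Hhat_l 1 s <= log2 r%:R :> R by apply: Hhat_1_le; rewrite ?sn.
have [] := hc s; rewrite -(ler_nat R) natrD => h5 _.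
rewrite -(ler_nat R) natrM -ler_pdivrMr//.
apply: le_trans hB; apply: (@le_trans _ _ ((size (Z s))%:R / n%:R + c%:R / n%:R)).
  by rewrite -mulrDl ler_pM2r ?invr_gt0.
lra.
Unshelve. all: by end_near. Qed.

Section entropy_and_complexity.
Context d (X : measurableType d) (R : realType) (mu : probability X R) (T : X -> X).
Hypothesis mT : measurable_fun setT T.
Hypothesis muT : forall B, measurable B -> mu (T @^-1` B) = mu B.
Context (r : nat) (A : 'I_r -> set X).
Hypothesis mA : forall i, measurable (A i).
Hypothesis disjA : forall i j, i != j -> A i `&` A j = set0.
Hypothesis coverA : \bigcup_(i in [set: 'I_r]) A i = [set: X].
Context (C : seq bool -> option (seq nat)) (Z : seq nat -> seq bool).
Hypothesis hC : universal_machine C.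
Hypothesis hZ : reversible_coding Z.
Hypothesis hZopt : @optimal_coding R Z.

Let hw x : words r (itinerary T A x) := words_itinerary T disjA coverA x.

Lemma K_AIC_le_K_Z x : (K_AIC C T A x <= K_Z Z T A x :> \bar R)%E.
Proof.
have [c hc] := AIC_le_coding hC hZ.
apply: (@le_limn_esup_error _ _ _ c%:R) => [n|n]; first by rewrite divr_ge0.
by rewrite -mulrDl ler_wpM2r// -natrD ler_nat; have [] := hc (itinerary T A x n).
Qed.

Lemma K_Z_le_Hhat_x x : (K_Z Z T A x <= Hhat_x T A x :> \bar R)%E.
Proof.
have [L hL _] := Hhat_limit R (hw x).
apply: lime_ge; first by apply/cvg_ex; exists L%:E.
near=> l; have l0 : (0 < l)%N by near: l; exact: near_ge1.
rewrite (limn_esup_Hhat R (hw x) l0).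
exact: limn_esup_coding_le (hw x) hZopt l0.
Unshelve. all: by end_near. Qed.

Lemma Hhat_x_le x l : (0 < l)%N ->
  (Hhat_x T A x <= (information_rate R (itinerary T A x) l / l%:R)%:E)%E.
Proof.
move=> l0; have [L /cvg_lim hL Lle] := Hhat_limit R (hw x).
by rewrite /Hhat_x hL// lee_fin Lle.
Qed.

Lemma measurable_limn_esup_itinerary (phi : nat -> seq nat -> R) :
  measurable_fun setT (fun x => limn_esup (fun n => (phi n (itinerary T A x n))%:E)).
Proof.
apply: measurable_fun_limn_esup => n; apply/measurable_EFinP.
exact: (@measurable_itinerary _ _ _ _ mT _ _ mA disjA coverA (phi n)).
Qed.

Lemma measurable_K_Z : measurable_fun setT (K_Z Z T A : X -> \bar R).
Proof. exact: (measurable_limn_esup_itinerary (fun n s => (size (Z s))%:R / n%:R)). Qed.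

Lemma measurable_K_AIC : measurable_fun setT (K_AIC C T A : X -> \bar R).
Proof. exact: (measurable_limn_esup_itinerary (fun n s => (AIC C s)%:R / n%:R)). Qed.

Lemma measurable_Hhat_x : measurable_fun setT (Hhat_x T A : X -> \bar R).
Proof.
apply: (@emeasurable_fun_cvg _ _ _ setT
    (fun l x => limn_esup (fun n => (Hhat_l l (itinerary T A x n) : R)%:E))) => [l|x _].
  exact: (measurable_limn_esup_itinerary (fun n s => Hhat_l l s)).
have [L hL _] := Hhat_limit R (hw x).
by rewrite /Hhat_x (cvg_lim _ hL).
Qed.

Lemma K_AIC_ge0 x : (0 <= K_AIC C T A x :> \bar R)%E.
Proof. by apply: limn_esup_ge0 => n; rewrite lee_fin divr_ge0. Qed.

Lemma K_Z_ge0 x : (0 <= K_Z Z T A x :> \bar R)%E.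
Proof. exact: le_trans (K_AIC_ge0 x) (K_AIC_le_K_Z x). Qed.

Lemma Hhat_x_ge0 x : (0 <= Hhat_x T A x :> \bar R)%E.
Proof. exact: le_trans (K_Z_ge0 x) (K_Z_le_Hhat_x x). Qed.

Lemma integral_Hhat_x_le l : (0 < l)%N ->
  (\int[mu]_x Hhat_x T A x <= ((word_entropy mu T A l + 1) / l%:R)%:E)%E.
Proof.
move=> l0; pose I x := limn_esup (fun n => (information R l (itinerary T A x n) / n%:R)%:E).
have mI : measurable_fun setT I.
  exact: (measurable_limn_esup_itinerary (fun n s => information R l s / n%:R)).
have I0 x : (0 <= I x)%E.
  by apply: limn_esup_ge0 => n; rewrite lee_fin divr_ge0 ?information_ge0.
have lV0 : 0 <= l%:R^-1 :> R by rewrite invr_ge0.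
apply: (@le_trans _ _ (\int[mu]_x (l%:R^-1%:E * I x))%E).
  apply: ge0_le_integral => //.
  - by move=> x _; exact: Hhat_x_ge0.
  - exact: measurable_Hhat_x.
  - exact: measurable_funeM.
  - move=> x _; rewrite /I -(information_rateE R l (hw x)) -EFinM mulrC.
    exact: Hhat_x_le.
rewrite ge0_integralZl_EFin// mulrC EFinM lee_wpmul2l ?lee_fin//.
exact: (integral_information_le mT muT mA disjA coverA l0).
Qed.

(** Half of [e] is spent on reverse Fatou, half on the logarithmic term [log2 (B * n).+1 / n]. *)
Lemma near_word_entropy_le : exists2 a : R, (\int[mu]_x K_AIC C T A x = a%:E)%E &
  forall e, 0 < e -> \forall n \near \oo, word_entropy mu T A n / n%:R <= a + e.
Proof.
have [B [N hB]] := near_AIC_le r hC hZ hZopt.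
have [c hc] := AIC_le_coding hC hZ.
pose f n x : R := (AIC C (itinerary T A x n))%:R / n%:R.
have mf n : measurable_fun setT (f n).
  exact: (@measurable_itinerary _ _ _ _ mT _ _ mA disjA coverA (fun s => (AIC C s)%:R / n%:R)).
have f0 n x : 0 <= f n x by rewrite divr_ge0.
have fB n x : (maxn 1 N <= n)%N -> f n x <= B%:R.
  rewrite geq_max => /andP[n0 Nn]; have [wn hr] := hw x n.
  by rewrite ler_pdivrMr ?ltr0n// -natrM ler_nat hB.
have [a aE ha] := limn_esup_integral_le mu mf f0 fB.
exists a => // e e0; have e20 : 0 < e / 2 by rewrite divr_gt0.
have {}ha := ha _ e20; have hlog := near_log2_ler B e20.
near=> n; have n0 : (0 < n)%N by near: n; exact: near_ge1.
have nR : (0 : R) < n%:R by rewrite ltr0n.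
have Nn : (N <= n)%N by near: n; exists N.
have h1 : (\int[mu]_x (f n x)%:E <= (a + e / 2)%:E)%E by near: n; exact: ha.
have h2 : log2 (B * n).+1%:R / n%:R <= e / 2 by near: n; exact: hlog.
(* A shortest program for each word; [g] is injective because the output of [C] recovers the
   word. *)
pose g (w : n.-tuple 'I_r) := projT1 (cid2 (hc (word_of w)).2).
have [gC gsize] : (forall w, C (g w) = Some (word_of w)) /\
    (forall w, size (g w) = AIC C (word_of w)).
  by split => w; rewrite /g; case: cid2.
have g_inj : injective g.
  by move=> v w vw; apply: word_of_inj; apply: Some_inj; rewrite -!gC vw.
have gB w : (size (g w) <= B * n)%N.
  by rewrite gsize hB ?size_word_of ?word_of_symbols.
have := word_entropy_le_code mu mT mA disjA coverA g_inj gsize gB.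
have -> : (\int[mu]_x ((AIC C (itinerary T A x n))%:R : R)%:E =
    n%:R%:E * \int[mu]_x (f n x)%:E)%E.
  rewrite -ge0_integralZl_EFin//; [|by move=> x _; rewrite lee_fin|exact/measurable_EFinP].
  by apply: eq_integral => x _; rewrite -EFinM /f mulrC divfK// gt_eqF.
have nE : (0%:E <= n%:R%:E :> \bar R)%E by rewrite lee_fin.
move=> h3; have := le_trans h3 (leeD2r _ (lee_wpmul2l nE h1)).
rewrite -EFinM -EFinD lee_fin => h4.
rewrite ler_pdivrMr// in h2; rewrite ler_pdivrMr//; lra.
Unshelve. all: by end_near. Qed.

Theorem entropy_rate_integrals : exists a : R,
  [/\ (fun n => word_entropy mu T A n / n%:R) @ \oo --> a,
      (\int[mu]_x K_AIC C T A x = a%:E)%E, (\int[mu]_x K_Z Z T A x = a%:E)%E &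
      (\int[mu]_x Hhat_x T A x = a%:E)%E].
Proof.
have [a aE ha] := near_word_entropy_le; exists a.
have KZ : (a%:E <= \int[mu]_x K_Z Z T A x)%E.
  rewrite -aE; apply: ge0_le_integral => //.
  - by move=> x _; exact: K_AIC_ge0.
  - exact: measurable_K_AIC.
  - exact: measurable_K_Z.
  - by move=> x _; exact: K_AIC_le_K_Z.
have ZH : (\int[mu]_x K_Z Z T A x <= \int[mu]_x Hhat_x T A x)%E.
  apply: ge0_le_integral => //.
  - by move=> x _; exact: K_Z_ge0.
  - exact: measurable_K_Z.
  - exact: measurable_Hhat_x.
  - by move=> x _; exact: K_Z_le_Hhat_x.
have Ha : (\int[mu]_x Hhat_x T A x <= a%:E)%E.
  apply/lee_addgt0Pr => e e0; have e20 : 0 < e / 2 by rewrite divr_gt0.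
  (* A single [l] suffices: large enough for the entropy rate to be within [e / 2] above [a] and for
     the extra bit to cost at most [e / 2]. *)
  have [l [l0 [h1 h2]]] := filter_ex (filterI near_ge1
    (filterI (ha _ e20) (@near_ler_inv R 1 _ e20))).
  apply: le_trans (integral_Hhat_x_le l0) _.
  by rewrite -EFinD lee_fin mulrDl; move: h1 h2 => /=; lra.
split => //.
- apply/cvgrPdist_le => e e0; have {}ha := ha _ e0.
  near=> n; have n0 : (0 < n)%N by near: n; exact: near_ge1.
  have h1 : word_entropy mu T A n / n%:R <= a + e by near: n; exact: ha.
  have h2 : 1 / n%:R <= e by near: n; exact: near_ler_inv.
  (* The chain of integrals read at length [n] gives [a <= (word_entropy mu T A n + 1) / n], the
     missing lower bound on the entropy rate. *)
  have := le_trans KZ (le_trans ZH (integral_Hhat_x_le n0)).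
  by rewrite lee_fin mulrDl ler_norml; lra.
- by apply/eqP; rewrite eq_le KZ (le_trans ZH Ha).
- by apply/eqP; rewrite eq_le Ha (le_trans KZ ZH).
Unshelve. all: by end_near. Qed.

End entropy_and_complexity.

(** * Application to Borel probability measures *)

Lemma continuous_borel_measurable (X : ptopologicalType) (T : X -> X) : continuous T ->
  measurable_fun setT (T : borel X -> borel X).
Proof.
move=> /continuousP cT; apply: (@measurability _ _ (borel X) (borel X) setT T (@open X)) => //.
move=> _ [B oB <-]; rewrite setTI; apply: sub_sigma_algebra; exact: cT.
Qed.

Local Open Scope ereal_scope.

Theorem theorem4p5 (R : realType) (X : pseudoPMetricType R) (hXmet : hausdorff_space X)
  (hX : compact [set: X]) (T : X -> X) (hT : continuous T)
  (mu : probability (borel X) R) (hmu : T_invariant T mu)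
  (C : seq bool -> option (seq nat)) (hC : universal_machine C)
  (Z : seq nat -> seq bool) (hZ : reversible_coding Z)
  (hZopt : @optimal_coding R Z)
  (r : nat) (A : 'I_r -> set X) (hA : measurable_partition A) :
  (h_KS mu T A)%:E = \int[mu]_x K_Z Z T A x /\
  \int[mu]_x K_Z Z T A x = \int[mu]_x Hhat_x T A x /\
  \int[mu]_x Hhat_x T A x = \int[mu]_x K_AIC C T A x.
Proof.
have [mA [disjA coverA]] := hA.
have [a [cvga AICa Za Ha]] := @entropy_rate_integrals _ (borel X) R mu T
  (continuous_borel_measurable hT) hmu r A mA disjA coverA C Z hC hZ hZopt.
rewrite Za Ha AICa; split => //; congr (_%:E); exact: (cvg_lim _ cvga).
Qed.
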